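(* Let $w_1,\dots,w_n$ be $n$ vectors spanning $\mathbb{R}^n$, let $m\geqslant1$ and let $(S_1,\dots,S_m)$ be a uniform cover of $[n]$ with weights $(p_1,\dots,p_m)$. Let $H_j=\mathrm{span}\{w_k : k\in S_j\}$, $\widetilde{H}_j=\mathrm{span}\{w_k : k\notin S_j\}$, $d_j=\dim H_j=|S_j|$, $\widetilde{d}_j=\dim\widetilde{H}_j=n-d_j$ and $p=\sum_{j=1}^m p_j$. Put $$BL_1:=\frac{\prod_{j=1}^m|\wedge_{k\in[n]\setminus S_j}w_k|^{p_j}}{|\wedge_{i=1}^n w_i|^{p-1}},\qquad BL_2:=\frac{\prod_{j=1}^m|\wedge_{k\in S_j}w_k|^{p_j}}{|\wedge_{i=1}^n w_i|}.$$ Then for every convex body $K\subseteq\mathbb{R}^n$ containing the origin the following inequalities hold: $$|K|\geqslant\frac{1}{BL_1}\cdot\frac{\prod_{j=1}^m(d_j!)^{p_j}}{n!}\prod_{j=1}^m|K\cap\widetilde{H}_j^\perp|^{p_j},$$ $$|K|^{p-1}\geqslant\frac{1}{BL_2}\cdot\frac{\prod_{j=1}^m(\widetilde{d}_j!)^{p_j}}{(n!)^{p-1}}\prod_{j=1}^m|K\cap H_j^\perp|^{p_j},$$ $$|K|\geqslant\frac{1}{BL_2}\cdot\frac{\prod_{j=1}^m(d_j!)^{p_j}}{n!}\prod_{j=1}^m|K\cap H_j|^{p_j},$$ $$|K|^{p-1}\geqslant\frac{1}{BL_1}\cdot\frac{\prod_{j=1}^m(\widetilde{d}_j!)^{p_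j}}{(n!)^{p-1}}\prod_{j=1}^m|K\cap\widetilde{H}_j|^{p_j}.$$
   Context: $[n]=\{1,\dots,n\}$. For $m\geqslant1$, subsets $S_1,\dots,S_m\subseteq[n]$ (not necessarily distinct) form a uniform cover of $[n]$ with weights $(p_1,\dots,p_m)$, $p_j>0$ for all $j$, if $\sum_{j=1}^m p_j\chi_{S_j}(i)=1$ for every $i\in[n]$. For vectors $u_1,\dots,u_k$, $|\wedge_{i=1}^k u_i|$ is the $k$-dimensional volume of the parallelepiped they span (equal to $1$ for the empty family). A convex body is a compact convex set with non-empty interior. $F^\perp$ is the orthogonal complement of the linear subspace $F$ of $\mathbb{R}^n$, and $|\cdot|$ of a set denotes Lebesgue measure in the corresponding subspace (unit point mass on $\{0\}$). *)

(* Defs.v *)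
From HB Require Import structures.
From mathcomp Require Import all_boot all_order all_algebra.
From mathcomp Require Import all_classical all_reals all_analysis.
From mathcomp Require Import zify.

Set Implicit Arguments.
Unset Strict Implicit.
Unset Printing Implicit Defensive.

Import Order.TTheory GRing.Theory Num.Theory.
Import numFieldNormedType.Exports.

Local Open Scope classical_set_scope.
Local Open Scope ring_scope.

Section lebesgue_tuple.
Context {R : realType}.
Local Open Scope ereal_scope.

Definition cons_tuple n
    (xt : measurableTypeR R * n.-tuple (measurableTypeR R)) :
    n.+1.-tuple (measurableTypeR R) := [tuple of xt.1 :: xt.2].

(* Lebesgue measure on R^n, as the n-fold product of [lebesgue_measure]. *)
Fixpoint lebesgue_tuple n : set (n.-tuple (measurableTypeR R)) -> \bar R :=
  match n with
  | 0 => \d_[tuple]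
  | k.+1 => pushforward (lebesgue_measure \x @lebesgue_tuple k) (@cons_tuple k)
  end.

Lemma measurable_cons_tuple n : measurable_fun setT (@cons_tuple n).
Proof. exact: measurable_cons. Qed.

Section cons_measure.
Variables (n : nat)
  (m : {sigma_finite_measure set (n.-tuple (measurableTypeR R)) -> \bar R}).

Let nu := pushforward (lebesgue_measure \x m) (@cons_tuple n).

Let nu0 : nu set0 = 0.
Proof. by rewrite /nu /pushforward preimage_set0 measure0. Qed.

Let nu_ge0 A : 0 <= nu A.
Proof. by rewrite /nu /pushforward; apply: measure_ge0. Qed.

Let nu_sigma_additive : semi_sigma_additive nu.
Proof.
have mc := @measurable_cons_tuple n.
move=> F mF tF mUF; rewrite /nu /pushforward preimage_bigcup.
apply: measure_semi_sigma_additive.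
- by move=> k; rewrite -[X in measurable X]setTI; exact: mc.
- apply/trivIsetP => /= i j _ _ ij; rewrite -preimage_setI.
  by move/trivIsetP : tF => /(_ _ _ _ _ ij) ->//; rewrite preimage_set0.
- by rewrite -preimage_bigcup -[X in measurable X]setTI; exact: mc.
Qed.

HB.instance Definition _ :=
  isMeasure.Build _ _ _ nu nu0 nu_ge0 nu_sigma_additive.

Let nu_sigma_finite : sigma_finite setT nu.
Proof.
pose u (t : n.+1.-tuple (measurableTypeR R)) := (thead t, [tuple of behead t]).
have mu : measurable_fun setT u.
  apply/measurable_fun_pair => /=; first exact: measurable_tnth.
  exact: measurable_behead.
pose l : {sigma_finite_measure set (measurableTypeR R) -> \bar R} :=
  lebesgue_measure.
have /sigma_finiteP[F [TF ndF Foo]] := sigma_finiteT l.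
have /sigma_finiteP[G [TG ndG Goo]] := sigma_finiteT m.
exists (fun k => u @^-1` (F k `*` G k)).
  rewrite -preimage_bigcup; apply/esym/seteqP; split=> // t _.
  have [i _ Fi] : (\bigcup_i F i) (thead t) by rewrite -TF.
  have [j _ Gj] : (\bigcup_i G i) [tuple of behead t] by rewrite -TG.
  exists (maxn i j) => //; split => /=.
    by move: Fi; exact/subsetPset/ndF/leq_maxl.
  by move: Gj; exact/subsetPset/ndG/leq_maxr.
move=> k; have [mFk Fk] := Foo k; have [mGk Gk] := Goo k; split.
  by rewrite -[X in measurable X]setTI; apply: mu => //; exact: measurableX.
rewrite /nu /pushforward -comp_preimage (_ : _ \o _ = id).
  rewrite preimage_id product_measure1E// lte_mul_pinfty//.
  by rewrite ge0_fin_numE//; exact: Fk.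
by apply/funext => -[x t]; rewrite /u /= theadE; congr pair; exact/val_inj.
Qed.

HB.instance Definition _ :=
  Measure_isSigmaFinite.Build _ _ _ nu nu_sigma_finite.

Lemma pushforward_cons_sigma_finite :
  exists l : {sigma_finite_measure set _ -> \bar R}, nu = l.
Proof. by exists nu. Qed.

End cons_measure.

Let lebesgue_tuple_ex n :
  exists l : {sigma_finite_measure set _ -> \bar R}, @lebesgue_tuple n = l.
Proof.
elim: n => [|n [l E]].
  by exists (\d_([tuple] : 0.-tuple (measurableTypeR R))).
by rewrite /= E; exact: pushforward_cons_sigma_finite.
Qed.

Let lebesgue_tuple0 n : @lebesgue_tuple n set0 = 0.
Proof. by have [l ->] := lebesgue_tuple_ex n; rewrite measure0. Qed.

Let lebesgue_tuple_ge0 n A : 0 <= @lebesgue_tuple n A.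
Proof. by have [l ->] := lebesgue_tuple_ex n; exact: measure_ge0. Qed.

Let lebesgue_tuple_sigma_additive n : semi_sigma_additive (@lebesgue_tuple n).
Proof.
by have [l ->] := lebesgue_tuple_ex n; exact: measure_semi_sigma_additive.
Qed.

HB.instance Definition _ n := isMeasure.Build _ _ _ (@lebesgue_tuple n)
  (@lebesgue_tuple0 n) (@lebesgue_tuple_ge0 n)
  (@lebesgue_tuple_sigma_additive n).

Let lebesgue_tuple_sigma_finite n : sigma_finite setT (@lebesgue_tuple n).
Proof. by have [l ->] := lebesgue_tuple_ex n; exact: sigma_finiteT. Qed.

HB.instance Definition _ n := Measure_isSigmaFinite.Build _ _ _
  (@lebesgue_tuple n) (@lebesgue_tuple_sigma_finite n).

Lemma lebesgue_tuple_box n (A : 'I_n -> set (measurableTypeR R)) :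
  (forall i, measurable (A i)) ->
  lebesgue_tuple [set t | forall i, A i (tnth t i)] =
    \prod_(i < n) lebesgue_measure (A i).
Proof.
elim: n A => [|n IHn] A mA.
  rewrite big_ord0 /= diracE mem_set//.
  by move=> [].
rewrite big_ord_recl -IHn// /= /pushforward.
rewrite (_ : _ @^-1` _ = A ord0 `*` [set t | forall i, A (lift ord0 i) (tnth t i)]).
  rewrite product_measure1E//.
  rewrite (_ : mkset _ = \big[setI/setT]_(i < n) ((fun t => tnth t i) @^-1` A (lift ord0 i))).
    apply: bigsetI_measurable => i _; rewrite -[X in measurable X]setTI.
    exact: measurable_tnth.
  apply/seteqP; split=> t /=.
    by move=> At; rewrite -bigcap_seq => i _; exact: At.
  by rewrite -bigcap_seq => At i; apply: (At i); rewrite /= mem_index_enum.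
apply/seteqP; split=> -[x t] /= => [xt|[x0 t0] i].
  split; first by have := xt ord0; rewrite tnth0.
  by move=> i; have := xt (lift ord0 i); rewrite tnthS.
by case: (unliftP ord0 i) => [j|] ->; rewrite ?tnthS// tnth0.
Qed.

End lebesgue_tuple.

Section subspace.
Context {R : realType}.

Definition row_of_tuple n (t : n.-tuple (measurableTypeR R)) : 'rV[R]_n :=
  \row_i tnth t i.

(* |A| for A bounded; [fine] sends the value +oo to 0. *)
Definition volume n (A : set 'rV[R]_n) : R :=
  fine (lebesgue_tuple (@row_of_tuple n @^-1` A)).

(* As in [mxalgebra], a linear subspace of R^n is the row space of a matrix;
   R^n carries the standard inner product [u *m v^T]. *)
Definition orthonormal_basis m n (F : 'M[R]_(m, n)) : 'M[R]_(\rank F, n) :=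
  xget 0 [set B : 'M[R]_(\rank F, n) | B *m B^T = 1%:M /\ (B == F)%MS].

(* Lebesgue measure of the subspace F, transported from R^(dim F) by the
   isometry x |-> x *m B; it does not depend on the orthonormal basis B since
   two of them differ by an orthogonal matrix. For dim F = 0 this is the unit
   point mass at 0. *)
Definition subspace_volume m n (F : 'M[R]_(m, n)) (A : set 'rV[R]_n) : R :=
  volume [set x : 'rV[R]_(\rank F) | A (x *m orthonormal_basis F)].

Definition subspace_set m n (F : 'M[R]_(m, n)) : set 'rV[R]_n :=
  [set x | (x <= F)%MS].

Definition orthmx m n (F : 'M[R]_(m, n)) : 'M[R]_n := kermx F^T.

Lemma sub_orthmx m n (F : 'M[R]_(m, n)) (v : 'rV[R]_n) :
  (v <= orthmx F)%MS <-> forall u : 'rV[R]_n, (u <= F)%MS -> v *m u^T = 0.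
Proof.
split=> [/sub_kermxP vF _ /submxP[c ->]|vF].
  by rewrite trmx_mul mulmxA vF mul0mx.
apply/sub_kermxP/rowP => i.
have /matrixP/(_ 0 0) := vF _ (row_sub i F); rewrite !mxE => vi.
by rewrite -[RHS]vi; apply: eq_bigr => j _; rewrite !mxE.
Qed.

Lemma gram_schmidt k n (A : 'M[R]_(k, n)) : row_free A ->
  exists B : 'M[R]_(k, n), B *m B^T = 1%:M /\ (B == A)%MS.
Proof.
elim: k A => [|k IHk] A Afree.
  by exists A; rewrite submx_refl (flatmx0 (A *m _)) (flatmx0 1%:M).
move: A Afree; rewrite -[k.+1]/(1 + k)%N => A.
rewrite -(vsubmxK A); move: (usubmx A) (dsubmx A) => {A} a A.
rewrite -row_leq_rank -addsmxE => rA.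
have [rAdd _] := mxrank_adds_leqif a A.
have ra := rank_leq_row a; have rA' := rank_leq_row A.
have Afree : row_free A.
  by rewrite -row_leq_rank; move: (leq_trans rA rAdd) ra; lia.
have aA : ~~ (a <= A)%MS.
  by apply/negP => /addsmx_idPr E; move: rA; rewrite E; lia.
have [B [BB /andP[BA AB]]] := IHk A Afree.
pose v := a - a *m B^T *m B.
have v0 : v != 0.
  apply: contra aA => /eqP/subr0_eq ->.
  exact: submx_trans (submxMl _ _) BA.
have vB : v *m B^T = 0 by rewrite mulmxBl -(mulmxA _ B) BB mulmx1 subrr.
have vv : v *m v^T = (\sum_i v 0 i ^+ 2)%:M.
  rewrite [LHS]mx11_scalar; congr _%:M; rewrite mxE.
  by apply: eq_bigr => i _; rewrite [v^T _ _]mxE expr2.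
set s := \sum_i _ in vv.
have s0 : 0 < s.
  rewrite lt0r; apply/andP; split; last first.
    by apply: sumr_ge0 => i _; exact: sqr_ge0.
  apply: contra v0 => /eqP s0; apply/eqP/rowP => i; rewrite [RHS]mxE.
  have h j : true -> 0 <= v 0 j ^+ 2 by rewrite sqr_ge0.
  have /eqP : v 0 i ^+ 2 = 0 by apply: (psumr_eq0P h s0).
  by rewrite sqrf_eq0 => /eqP.
pose c := (Num.sqrt s)^-1.
have c0 : c != 0 by rewrite invr_neq0// gt_eqF// sqrtr_gt0.
exists (col_mx (c *: v) B); split.
  rewrite tr_col_mx mul_col_row linearZ /= -!scalemxAl -!scalemxAr vv vB BB.
  rewrite -[B *m v^T]trmxK trmx_mul trmxK vB trmx0 !scaler0 scalerA.
  rewrite -invfM -expr2 sqr_sqrtr ?ltW// scale_scalar_mx mulVf ?gt_eqF//.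
  by rewrite -scalar_mx_block.
rewrite -!addsmxE; apply/andP; split; rewrite addsmx_sub; apply/andP; split.
- rewrite scalemx_sub// /v addmx_sub//; first exact: addsmxSl.
  rewrite eqmx_opp (submx_trans (submxMl _ _))// (submx_trans BA)//.
  exact: addsmxSr.
- by rewrite (submx_trans BA)// addsmxSr.
- rewrite -[a](subrK (a *m B^T *m B)) -/v addmx_sub//.
    rewrite (submx_trans _ (addsmxSl _ _))//.
    by rewrite (eqmx_scale v c0).
  by rewrite (submx_trans (submxMl _ _))// addsmxSr.
- by rewrite (submx_trans AB)// addsmxSr.
Qed.

Lemma orthonormal_basisP m n (F : 'M[R]_(m, n)) :
  let B := orthonormal_basis F in B *m B^T = 1%:M /\ (B == F)%MS.
Proof.
rewrite /= /orthonormal_basis; case: xgetP => [B _ //|noB]; exfalso.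
have [B [BB BF]] := gram_schmidt (row_base_free F).
apply: (noB B); split=> //; apply/eqmxP.
exact: eqmx_trans (eqmxP BF) (eq_row_base F).
Qed.

End subspace.

Section brascamp_lieb.
Context {R : realType}.

Definition spanmx n (w : 'I_n -> 'rV[R]_n) (S : {set 'I_n}) : 'M[R]_n :=
  (\sum_(k in S) <<w k>>)%MS.

Definition parallelepiped n (w : 'I_n -> 'rV[R]_n) (S : {set 'I_n}) :
    set 'rV[R]_n :=
  [set x | exists2 t : 'I_n -> R,
    forall k, 0 <= t k <= 1 & x = \sum_(k in S) t k *: w k].

(* The #|S|-dimensional volume of the parallelepiped, which is 0 when the
   vectors are linearly dependent. *)
Definition wedge_norm n (w : 'I_n -> 'rV[R]_n) (S : {set 'I_n}) : R :=
  if \rank (spanmx w S) == #|S| then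
    subspace_volume (spanmx w S) (parallelepiped w S)
  else 0.

Lemma rank_spanmx n (w : 'I_n -> 'rV[R]_n) (S : {set 'I_n}) :
  (spanmx w [set: 'I_n]%SET == 1%:M)%MS -> \rank (spanmx w S) = #|S|.
Proof.
have rk T : (\rank (spanmx w T) <= #|T|)%N.
  rewrite -sum1_card /spanmx; elim/big_rec2 : _ => [|k x y _ IH].
    by rewrite mxrank0.
  have [le _] := mxrank_adds_leqif <<w k>>%MS x.
  rewrite (leq_trans le)// leq_add//.
  by rewrite mxrank_gen rank_leq_row.
move=> /eqmx_rank; rewrite mxrank1 => rT.
have wE : spanmx w [set: 'I_n]%SET = (spanmx w S + spanmx w (~: S))%MS.
  rewrite /spanmx (bigID [in S]) /=; congr (_ + _)%MS.
    by apply: eq_bigl => i; rewrite inE.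
  by apply: eq_bigl => i; rewrite !inE.
have [le _] := mxrank_adds_leqif (spanmx w S) (spanmx w (~: S)).
move: le (rk S) (rk (~: S)) (cardsC S); rewrite -wE rT card_ord.
lia.
Qed.

Definition uniform_cover n m (S : 'I_m -> {set 'I_n}) (p : 'I_m -> R) : Prop :=
  (forall j, 0 < p j) /\
  (forall i, \sum_(j < m) p j * (i \in S j)%:R = 1).

Definition BL1 n m (w : 'I_n -> 'rV[R]_n) (S : 'I_m -> {set 'I_n})
    (p : 'I_m -> R) : R :=
  (\prod_(j < m) wedge_norm w (~: S j) `^ p j) /
  wedge_norm w [set: 'I_n]%SET `^ (\sum_(j < m) p j - 1).

Definition BL2 n m (w : 'I_n -> 'rV[R]_n) (S : 'I_m -> {set 'I_n})
    (p : 'I_m -> R) : R :=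
  (\prod_(j < m) wedge_norm w (S j) `^ p j) / wedge_norm w [set: 'I_n]%SET.

Definition convex_body n (K : set 'rV[R]_n) : Prop :=
  [/\ compact K, convex_set K & K° !=set0].

End brascamp_lieb.

(* Main.v *)
Require Import Defs.
From mathcomp Require Import all_boot all_order all_algebra.
From mathcomp Require Import all_classical all_reals all_analysis.
From mathcomp Require Import measurable_realfun ring lra.

Set Implicit Arguments.
Unset Strict Implicit.
Unset Printing Implicit Defensive.

Import Order.TTheory GRing.Theory Num.Theory.
Import numFieldNormedType.Exports.
Local Open Scope classical_set_scope.
Local Open Scope ring_scope.

(** All four inequalities are instances of one inequality for an invertible
    matrix V with rows v_1, ..., v_n and a uniform cover (S_j, p_j):

      n! |K| >= |det V| prod_j (d_j! |K /\ F_j| / |wedge_{k in S_j} v_k|) ^ p_j,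

    where F_j is the span of the v_k with k in S_j and d_j = #|S_j|. The third
    inequality is the case where V has rows w_k. For the first, V is the dual
    basis: the v_k with k in S_j span the orthogonal complement of the w_k with
    k outside S_j, and by the complementary minor identity the wedge of the
    former is the wedge of the latter divided by |det W|. The second and the
    fourth apply the same to the complements of the S_j, which form a uniform
    cover with weights p_j / (p - 1), and raise the result to the power p - 1;
    when p = 1 or n = 0 the complements are empty and everything equals 1.

    The linear map V reduces the inequality to coordinate subspaces
    (scales_volume_unit, row_sections_volume). There, let
    g (x) = min {t >= 0 | x in t K} be the gauge of K, infinite outside the
    cone over K. Its level sets are dilates of K, so that the integral of
    exp (- g) over a d-dimensional subspace F is
    |K /\ F| * int_0^oo t ^ d exp (- t) dt = d! |K /\ F| (integral_exp_gauge),
    and its convexity reads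
    prod_j exp (- g (x_j)) ^ p_j <= exp (- g (sum_j p_j x_j))
    (exp_gauge_prod_le). It thus suffices to compare the integral of a function
    h over R^n with those of functions f_j over coordinate subspaces whenever
    prod_j f_j (x_j) ^ p_j <= h (sum_j p_j x_j) (reverse_finner). Integrating
    out one coordinate at a time, this comes down to the inequality of Prekopa
    and Leindler on the line with several functions, whose weights sum to 1
    because the cover is uniform. That inequality follows from the
    Brunn-Minkowski inequality on the line by integrating over superlevel
    sets. *)

(** * Affine maps of the line and slices of Lebesgue measure on row vectors *)

Section affine_line.
Context {R : realType}.
Local Notation leb := (@lebesgue_measure R).
Implicit Types E : set (measurableTypeR R).


Lemma measurable_aff (a c : R) :
  measurable_fun setT (fun x : measurableTypeR R => (a * x + c : measurableTypeR R)).
Proof. by apply: measurable_funD => //; exact: measurable_funM. Qed.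

Lemma lebesgue_measure_aff (a c : R) E : a != 0 -> measurable E ->
  leb [set x | E (a * x + c)] = (`|a|^-1%:E * leb E)%E.
Proof.
move=> a0 mE.
have na0 : 0 < `|a| by rewrite normr_gt0.
pose phi (x : measurableTypeR R) : measurableTypeR R := a * x + c.
have mphi : measurable_fun setT phi by exact: measurable_aff.
pose push : {measure set (measurableTypeR R) -> \bar R} :=
  measure_function_pushforward__canonical__measure_function_Measure leb mphi.
pose nu := mscale (NngNum (ltW na0)) push.
have nuE X : nu X = (`|a|%:E * leb (phi @^-1` X))%E by [].
suff : leb E = nu E.
  move=> ->; rewrite nuE muleA -EFinM mulVf ?mul1e//.
  by rewrite gt_eqF.
apply: (@lebesgue_measure_unique R nu) => // X [[u v] _ <-].
rewrite -[RHS]/(`|a|%:E * leb (phi @^-1` [set` `]u, v]]))%E.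
have [a1|a1] := ltP 0 a.
  rewrite (_ : _ @^-1` _ = [set` `](u - c) / a, (v - c) / a]]); last first.
    apply/seteqP; split => x /=; rewrite !in_itv/= /phi ltr_pdivrMr// ler_pdivlMr//.
      by move=> /andP[? ?]; apply/andP; split; lra.
    by move=> /andP[? ?]; apply/andP; split; lra.
  rewrite !lebesgue_measure_itv/= !lte_fin ltr_pM2r ?invr_gt0// ltrD2r.
  case: ifPn => uv; last by rewrite mule0.
  by rewrite -EFinB -EFinM gtr0_norm//; congr EFin; field.
have {}a1 : a < 0 by rewrite lt_neqAle a0.
rewrite (_ : _ @^-1` _ = [set` `[(v - c) / a, (u - c) / a[]); last first.
  apply/seteqP; split => x /=; rewrite !in_itv/= /phi ler_ndivrMr// ltr_ndivlMr//.
    by move=> /andP[? ?]; apply/andP; split; lra.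
  by move=> /andP[? ?]; apply/andP; split; lra.
rewrite !lebesgue_measure_itv/= !lte_fin ltr_nM2r ?invr_lt0// ltrD2r.
case: ifPn => uv; last by rewrite mule0.
by rewrite -EFinB -EFinM ltr0_norm//; congr EFin; field.
Qed.

Lemma ge0_integral_aff (a c : R) (f : measurableTypeR R -> \bar R) : a != 0 ->
  measurable_fun setT f -> (forall x, 0 <= f x)%E ->
  (\int[leb]_x f (a * x + c)%R = `|a|^-1%:E * \int[leb]_x f x)%E.
Proof.
move=> a0 mf f0.
have na0 : 0 < `|a|^-1 by rewrite invr_gt0 normr_gt0.
pose phi (x : measurableTypeR R) : measurableTypeR R := a * x + c.
have mphi : measurable_fun setT phi by exact: measurable_aff.
pose push : {measure set (measurableTypeR R) -> \bar R} :=
  measure_function_pushforward__canonical__measure_function_Measure leb mphi.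
transitivity (\int[push]_x f x)%E.
  by rewrite ge0_integral_pushforward.
transitivity (\int[mscale (NngNum (ltW na0)) leb]_x f x)%E; last first.
  by rewrite ge0_integral_mscale.
apply: (@eq_measure_integral _ _ _ _ (mscale (NngNum (ltW na0)) leb) push) => A mA _.
exact: lebesgue_measure_aff.
Qed.

End affine_line.

Section row_volume.
Context {R : realType}.
Local Notation leb := (@lebesgue_measure R).
Local Notation T := (measurableTypeR R).

(** The measure lives on tuples, but the linear algebra on row vectors. *)
Definition row_measurable n (E : set 'rV[R]_n) :=
  measurable (@row_of_tuple R n @^-1` E).

Definition row_measure n (E : set 'rV[R]_n) : \bar R :=
  lebesgue_tuple (@row_of_tuple R n @^-1` E).

Definition tuple_of_row n (x : 'rV[R]_n) : n.-tuple T := [tuple x 0 i | i < n].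

Lemma tuple_of_rowK n : cancel (@tuple_of_row n) (@row_of_tuple R n).
Proof. by move=> x; apply/rowP => i; rewrite !mxE tnth_mktuple. Qed.

Lemma row_of_tupleK n : cancel (@row_of_tuple R n) (@tuple_of_row n).
Proof. by move=> t; apply/eq_from_tnth => i; rewrite tnth_mktuple mxE. Qed.

Lemma row_of_cons n (t : T) (x : n.-tuple T) :
  row_of_tuple (Defs.cons_tuple (t, x)) = row_mx t%:M (row_of_tuple x) :> 'rV[R]_(1 + n).
Proof.
apply/rowP => i; rewrite !mxE.
case: splitP => j ij; rewrite ?ord1 !mxE.
  by rewrite (_ : i = ord0) ?tnth0//; apply/val_inj; rewrite /= ij ord1.
by rewrite (_ : i = lift ord0 j) ?tnthS//; apply/val_inj; rewrite /= ij.
Qed.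

Lemma measurable_affine_tuple k n (A : 'M[R]_(k, n)) (c : 'rV[R]_n) :
  measurable_fun setT
    (fun x : k.-tuple T => tuple_of_row (row_of_tuple x *m A + c)).
Proof.
apply/measurable_fun_tnthP => i.
rewrite (_ : _ \o _ = fun x : k.-tuple T => (\sum_j tnth x j * A j i + c 0 i : T)).
  apply: measurable_funD => //; apply: measurable_sum => j.
  by apply: measurable_funM => //; exact: measurable_tnth.
apply/funext => x /=; rewrite tnth_mktuple !mxE; congr (_ + _).
by apply: eq_bigr => j _; rewrite mxE.
Qed.

Lemma row_measurable_affine k n (A : 'M[R]_(k, n)) (c : 'rV[R]_n) (E : set 'rV[R]_n) :
  row_measurable E -> row_measurable [set x | E (x *m A + c)].
Proof.
move=> mE; have := measurable_affine_tuple A c measurableT mE; rewrite setTI.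
by congr (measurable _); apply/seteqP; split => x /=; rewrite tuple_of_rowK.
Qed.

Lemma row_measurable_mul k n (A : 'M[R]_(k, n)) (E : set 'rV[R]_n) :
  row_measurable E -> row_measurable [set x | E (x *m A)].
Proof.
move=> /(row_measurable_affine A 0).
by congr row_measurable; apply/seteqP; split => x /=; rewrite addr0.
Qed.

Lemma row_measurable_cons n (E : set 'rV[R]_(1 + n)) : row_measurable E ->
  measurable ([set u | E (row_mx u.1%:M (row_of_tuple u.2))] : set (T * n.-tuple T)).
Proof.
move=> mE; have := @measurable_cons_tuple R n measurableT _ mE; rewrite setTI.
by congr (measurable _); apply/seteqP; split => -[x t] /=; rewrite row_of_cons.
Qed.

Lemma row_measurable_slice n (E : set 'rV[R]_(1 + n)) (t : R) :
  row_measurable E -> row_measurable [set x | E (row_mx t%:M x)].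
Proof.
move=> /row_measurable_cons /(measurable_xsection t).
by congr (measurable _); apply/seteqP; split => x /=; rewrite /xsection/= inE.
Qed.

Lemma row_measure_slice n (E : set 'rV[R]_(1 + n)) :
  (row_measure E = \int[leb]_t row_measure [set x | E (row_mx t%:M x)])%E.
Proof.
rewrite /row_measure/= /pushforward /product_measure1; apply: eq_integral => t _ /=.
congr lebesgue_tuple; apply/seteqP.
by split => x /=; rewrite /xsection/= inE/= row_of_cons.
Qed.

Lemma measurable_row_measure_slice n (E : set 'rV[R]_(1 + n)) : row_measurable E ->
  measurable_fun setT (fun t : T => row_measure [set x | E (row_mx t%:M x)]).
Proof.
move=> /row_measurable_cons mE.
have := measurable_fun_xsection (@lebesgue_tuple R n) mE.
congr measurable_fun; apply/funext => t /=; congr lebesgue_tuple.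
by apply/seteqP; split => x /=; rewrite /xsection/= inE.
Qed.

(** The order of integration opposite to the one that defines lebesgue_tuple; it
    is the one adapted to maps that only move the first coordinate. *)
Lemma row_measure_slice2 n (E : set 'rV[R]_(1 + n)) : row_measurable E ->
  (row_measure E = \int[@lebesgue_tuple R n]_x
     leb [set t | E (row_mx t%:M (row_of_tuple x))])%E.
Proof.
move=> /row_measurable_cons mE.
transitivity ((leb \x @lebesgue_tuple R n)%E [set u | E (row_mx u.1%:M (row_of_tuple u.2))]).
  rewrite /row_measure /= /pushforward; congr (product_measure1 _ _).
  by apply/seteqP; split => -[t x] /=; rewrite row_of_cons.
rewrite (@product_measure_unique _ _ _ _ _ leb (@lebesgue_tuple R n)
   (leb \x^ @lebesgue_tuple R n)%E)//; last first.
  by move=> A B mA mB; exact: product_measure2E.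
rewrite /product_measure2; apply: eq_integral => x _ /=.
by congr leb; apply/seteqP; split => t /=; rewrite /ysection/= inE.
Qed.

End row_volume.

(** * Linear change of variables *)

Section linear_change.
Context {R : realType}.
Local Notation leb := (@lebesgue_measure R).
Local Notation T := (measurableTypeR R).

Lemma row_measure_translate n (c : 'rV[R]_n) (E : set 'rV[R]_n) :
  row_measurable E -> row_measure [set x | E (x + c)] = row_measure E.
Proof.
elim: n c E => [|n IHn] c E mE.
  by congr row_measure; apply/seteqP; split => x /=; rewrite !(thinmx0 (_ + c)) (thinmx0 x).
rewrite -[n.+1]/(1 + n)%N in c E mE *.
rewrite !row_measure_slice.
pose c0 := lsubmx c; pose c1 := rsubmx c.
pose f (t : T) := row_measure [set x | E (row_mx t%:M x)].
transitivity (\int[leb]_t f (1 * t + c0 0 0)%R)%E.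
  apply: eq_integral => t _; rewrite /f -[RHS](IHn c1); last exact: row_measurable_slice.
  congr row_measure; apply/seteqP; split => x /=.
    by rewrite -[c]hsubmxK add_row_mx (mx11_scalar (lsubmx c)) -raddfD mul1r.
  by rewrite -[c in E (_ + c)]hsubmxK add_row_mx (mx11_scalar (lsubmx c)) -raddfD mul1r.
rewrite ge0_integral_aff//; first by rewrite normr1 invr1 mul1e.
exact: measurable_row_measure_slice.
Qed.

Definition scales_volume n (A : 'M[R]_n) := forall E, row_measurable E ->
  row_measure [set x | E (x *m A)] = (`|\det A|^-1%:E * row_measure E)%E.

Lemma scales_volumeM n (A B : 'M[R]_n) :
  scales_volume A -> scales_volume B -> scales_volume (A *m B).
Proof.
move=> sA sB E mE.
transitivity (row_measure [set x | [set y | E (y *m B)] (x *m A)]).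
  by congr row_measure; apply/seteqP; split => x /=; rewrite mulmxA.
rewrite sA; last exact: row_measurable_mul.
by rewrite sB// muleA -EFinM det_mulmx normrM invfM.
Qed.

(** On each slice by the first coordinate, the map is the lower right block
    followed by a translation, and it moves the slice at t to the slice at
    a * t. *)
Lemma scales_volume_ublock n (a : R) (b : 'rV[R]_n) (D : 'M[R]_n) : a != 0 ->
  scales_volume D -> scales_volume (block_mx a%:M b 0 D : 'M[R]_(1 + n)).
Proof.
move=> a0 sD E mE; rewrite !row_measure_slice.
pose f (t : T) := row_measure [set x | E (row_mx t%:M x)].
have mf : measurable_fun setT f by exact: measurable_row_measure_slice.
transitivity (\int[leb]_t (`|\det D|^-1%:E * f (a * t + 0)%R))%E.
  apply: eq_integral => t _; rewrite /f addr0.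
  transitivity (row_measure [set x | [set y | E (row_mx (a * t)%:M (y + t *: b))] (x *m D)]).
    congr row_measure; apply/seteqP; split => x /=;
    by rewrite mul_row_block mulmx0 addr0 !mul_scalar_mx scale_scalar_mx mulrC addrC.
  have mEt := row_measurable_slice (a * t) mE.
  rewrite sD; last first.
    have := row_measurable_affine 1%:M (t *: b) mEt.
    by congr row_measurable; apply/seteqP; split => x /=; rewrite mulmx1.
  by rewrite (row_measure_translate (t *: b) mEt).
rewrite ge0_integralZl_EFin//=; last first.
  by apply: (@measurableT_comp _ _ _ _ _ _ f) => //; exact: measurable_aff.
rewrite ge0_integral_aff//.
by rewrite muleA -EFinM det_ublock det_scalar1 normrM invfM mulrC.
Qed.

(** On each line parallel to the first axis, the map is a translation. *)
Lemma scales_volume_shear n (c : 'cV[R]_n) :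
  scales_volume (block_mx 1%:M 0 c 1%:M : 'M[R]_(1 + n)).
Proof.
move=> E mE; rewrite det_lblock !det1 mulr1 normr1 invr1 mul1e.
rewrite !row_measure_slice2//; last exact: row_measurable_mul.
apply: eq_integral => x _; set y := row_of_tuple x.
pose F : set T := [set t | E (row_mx t%:M y)].
have mF : measurable F.
  have := row_measurable_cons mE => /(measurable_ysection x).
  by congr measurable; apply/seteqP; split => t /=; rewrite /ysection/= inE.
have [s ycE] : exists s : R, y *m c = s%:M by exists ((y *m c) 0 0); exact: mx11_scalar.
transitivity (leb [set t | F (1 * t + s)]); last first.
  by rewrite lebesgue_measure_aff// normr1 invr1 mul1e.
congr leb; apply/seteqP; split => t /=;
by rewrite /F/= mul_row_block !mulmx1 mulmx0 add0r mul1r ycE -raddfD.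
Qed.

(** The Jacobian of a linear map is its determinant. By induction on the
    dimension: once the top left entry is nonzero, Gaussian elimination writes
    the matrix as a shear times a block upper triangular matrix; if it is zero,
    another shear makes it nonzero. *)
Theorem scales_volume_unit n (A : 'M[R]_n) : A \in unitmx -> scales_volume A.
Proof.
elim: n A => [|n IHn] A uA.
  move=> E mE; rewrite det_mx00 normr1 invr1 mul1e.
  by congr row_measure; apply/seteqP; split => x /=; rewrite (thinmx0 (x *m A)) (thinmx0 x).
rewrite -[n.+1]/(1 + n)%N in A uA *.
have sA1 : forall B : 'M[R]_(1 + n), B \in unitmx -> B 0 0 != 0 -> scales_volume B.
  move=> B uB B0; pose a := B 0 0.
  have BE : B = block_mx 1%:M 0 (a^-1 *: dlsubmx B) 1%:M *m
      block_mx a%:M (ursubmx B) 0 (drsubmx B - a^-1 *: dlsubmx B *m ursubmx B).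
    rewrite mulmx_block !mul1mx !mul0mx !addr0 [_ + (_ - _)]addrC subrK.
    rewrite mul_mx_scalar scalerA divff// scale1r.
    rewrite -[LHS]submxK; congr block_mx.
    rewrite [LHS]mx11_scalar; congr _%:M; rewrite !mxE.
    by congr (B _ _); apply/val_inj.
  rewrite BE; apply: scales_volumeM; first exact: scales_volume_shear.
  apply: scales_volume_ublock => //; apply: IHn.
  move: uB; rewrite {1}BE unitmx_mul => /andP[_].
  by rewrite !unitmxE det_ublock unitrM => /andP[_].
have [A0|] := eqVneq (A 0 0) 0; last exact: sA1.
have [i Ai] : exists i, A i 0 != 0.
  apply/not_existsP => A00; move: uA; rewrite unitmxE.
  rewrite (expand_det_col _ 0) big1 ?unitr0// => i _.
  by have /negP := A00 i; rewrite negbK => /eqP ->; rewrite mul0r.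
have {}Ai : (dlsubmx A) != 0.
  apply: contra Ai => /eqP dlA.
  case: (unliftP ord0 i) => [j ->|->]; last by rewrite A0.
  have /matrixP/(_ j 0) := dlA; rewrite !mxE => dj; apply/eqP.
  by rewrite -[RHS]dj; congr (A _ _); apply/val_inj.
have [j Aj] : exists j, dlsubmx A j 0 != 0.
  apply/not_existsP => A00; move/eqP : Ai; apply; apply/matrixP => j k.
  by have /negP := A00 j; rewrite negbK ord1 => /eqP ->; rewrite mxE.
(* adding row j to the top row of A is undone by subtracting it *)
pose U (s : R) : 'M[R]_(1 + n) := block_mx 1%:M (s *: delta_mx 0 j) 0 1%:M.
have UU : U (-1) *m U 1 = 1%:M.
  rewrite /U mulmx_block !mul1mx !mulmx0 !mul0mx !mulmx1 !addr0 !add0r scaleN1r scale1r.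
  by rewrite subrr -scalar_mx_block.
have uU s : U s \in unitmx by rewrite unitmxE det_ublock !det1 mulr1 unitr1.
have -> : A = U (-1) *m (U 1 *m A) by rewrite mulmxA UU mul1mx.
apply: scales_volumeM.
  by apply: scales_volume_ublock; [exact: oner_neq0|apply: IHn; exact: unitmx1].
apply: sA1; first by rewrite unitmx_mul uU.
rewrite -[A]submxK mulmx_block !mul1mx !scale1r.
rewrite -rowE !mxE/=.
case: splitP => // k _; rewrite !mxE.
case: splitP => // l _; rewrite !ord1 !mxE.
rewrite (_ : A _ _ = 0) ?add0r; last by rewrite -[RHS]A0; congr (A _ _); apply/val_inj.
by apply: contra Aj => /eqP <-; rewrite !mxE.
Qed.

End linear_change.

(** * Products of real powers and the Brunn-Minkowski inequality on the line *)

Section powR_big.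
Context {R : realType}.

Lemma powR_prod (I : Type) (r : seq I) (P : pred I) (a : I -> R) (x : R) :
  (forall i, 0 <= a i) ->
  (\prod_(i <- r | P i) a i) `^ x = \prod_(i <- r | P i) a i `^ x.
Proof.
move=> a0.
suff [_ ->] : 0 <= \prod_(i <- r | P i) a i /\
    (\prod_(i <- r | P i) a i) `^ x = \prod_(i <- r | P i) a i `^ x by [].
elim/big_ind2 : _ => [|y y' z z' [y0 <-] [z0 <-]|i _]; first by rewrite powR1.
  by rewrite powRM// mulr_ge0.
by [].
Qed.

Lemma powR_sum (I : Type) (r : seq I) (P : pred I) (p : I -> R) (x : R) : 0 < x ->
  x `^ (\sum_(i <- r | P i) p i) = \prod_(i <- r | P i) x `^ p i.
Proof.
move=> x0; elim/big_rec2 : _ => [|i y z _ <-]; first by rewrite powRr0.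
by rewrite powRD//; apply/implyP => _; rewrite gt_eqF.
Qed.

Lemma powRV (a x : R) : 0 <= a -> a^-1 `^ x = (a `^ x)^-1.
Proof. by move=> a0; rewrite -[a^-1]powR_inv1// -powRrM mulN1r powRN. Qed.

Lemma powR_le_expR (x p : R) : 0 <= x -> 0 < p -> x `^ p <= expR (p * (x - 1)).
Proof.
rewrite le_eqVlt => /predU1P[<-|x0] p0; first by rewrite powR0 ?gt_eqF// expR_ge0.
rewrite /powR gt_eqF// ler_expR ler_pM2l//.
by have := le_ln1Dx (x := x - 1); rewrite addrCA subrr addr0; apply; lra.
Qed.

(** After division of the a i by their weighted mean, the product is at most 1:
    bounding x ^ p by exp (p (x - 1)) leaves the exponential of a sum equal
    to 0. *)
Lemma weighted_AM_GM (I : eqType) (r : seq I) (p a : I -> R) :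
  (forall i, i \in r -> 0 < p i) -> \sum_(i <- r) p i = 1 -> (forall i, 0 <= a i) ->
  \prod_(i <- r) a i `^ p i <= \sum_(i <- r) p i * a i.
Proof.
move=> p0 p1 a0; set s := \sum_(i <- r) p i * a i.
have pa0 i : i \in r -> 0 <= p i * a i by move=> /p0/ltW pi; exact: mulr_ge0.
have : 0 <= s by rewrite /s big_seq; apply: sumr_ge0 => i /pa0.
rewrite le_eqVlt => /predU1P[s0|s0].
  case: r => [|i r] in p0 p1 @s s0 pa0 *.
    by exfalso; have := oner_neq0 R; rewrite -p1 big_nil eqxx.
  have : p i * a i <= s.
    rewrite /s big_cons lerDl big_seq; apply: sumr_ge0 => j jr.
    by apply: pa0; rewrite inE jr orbT.
  rewrite -s0 pmulr_rle0 ?p0 ?mem_head// => ai.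
  have ai0 : a i = 0 by apply/eqP; rewrite eq_le ai a0.
  by rewrite big_cons ai0 powR0 ?mul0r// gt_eqF// p0 ?mem_head.
have -> : \prod_(i <- r) a i `^ p i = s * \prod_(i <- r) (a i / s) `^ p i.
  rewrite {1}(_ : s = \prod_(i <- r) s `^ p i); last by rewrite -powR_sum// p1 powRr1// ltW.
  rewrite -big_split/=.
  by apply: eq_bigr => i _; rewrite -powRM ?divr_ge0 ?(ltW s0)// mulrCA divff ?mulr1// gt_eqF.
rewrite -[leRHS]mulr1 ler_pM2l//.
apply: (@le_trans _ _ (\prod_(i <- r) expR (p i * (a i / s - 1)))).
  rewrite [leLHS]big_seq [leRHS]big_seq; apply: ler_prod => i ir.
  by rewrite powR_ge0 powR_le_expR ?p0// divr_ge0// ltW.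
rewrite -expR_sum -[leRHS]expR0 ler_expR; under eq_bigr do rewrite mulrBr mulr1 mulrA.
by rewrite sumrB -mulr_suml p1 divff ?subrr// gt_eqF.
Qed.

End powR_big.

Section brunn_minkowski_line.
Context {R : realType}.
Local Notation leb := (@lebesgue_measure R).
Local Notation T := (measurableTypeR R).

Definition sumset (A B : set R) : set R := [set x + y | x in A & y in B].

Lemma compact_sumset (A B : set R) : compact A -> compact B -> compact (sumset A B).
Proof.
move=> cA cB.
have -> : sumset A B = (fun u : R * R => u.1 + u.2) @` (A `*` B).
  apply/seteqP; split=> [z [x Ax [y By <-]]|z [[x y] [/= Ax By] <-]].
    by exists (x, y).
  by exists x => //; exists y.
apply: continuous_compact; last exact: compact_setX.
apply: continuous_subspaceT => u; apply: add_continuous.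
Qed.

(** The translates of A by the least point of B and of B by the greatest point
    of A both lie in the sumset, and they share at most one point. *)
Lemma lebesgue_sumset (A B : set T) : compact A -> compact B ->
  A !=set0 -> B !=set0 -> (leb A + leb B <= leb (sumset A B))%E.
Proof.
move=> cA cB A0 B0.
have [a Aa maxa] : exists2 a, A a & forall x, A x -> x <= a.
  have [a] := @compact_EVT_max _ _ id A A0 cA (@continuous_subspaceT _ _ A id (fun x => cvg_id)).
  by rewrite inE => Aa ha; exists a => // x Ax; apply: ha; rewrite inE.
have [b Bb minb] : exists2 b, B b & forall x, B x -> b <= x.
  have [b] := @compact_EVT_min _ _ id B B0 cB (@continuous_subspaceT _ _ B id (fun x => cvg_id)).
  by rewrite inE => Bb hb; exists b => // x Bx; apply: hb; rewrite inE.
have mA : measurable A by exact: compact_measurable.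
have mB : measurable B by exact: compact_measurable.
have mB' : measurable (B `\ b) by exact: measurableD.
pose A1 : set T := [set x | A (1 * x + - b)].
pose B1 : set T := [set x | (B `\ b) (1 * x + - a)].
have mA1 : measurable A1 by rewrite -[A1]setTI; apply: measurable_aff.
have mB1 : measurable B1 by rewrite -[B1]setTI; apply: measurable_aff.
have -> : leb A = leb A1.
  by rewrite lebesgue_measure_aff// normr1 invr1 mul1e.
have -> : leb B = leb B1.
  rewrite lebesgue_measure_aff// normr1 invr1 mul1e.
  rewrite -{1}(setD1K Bb) measureU//=; last by rewrite setDE setICA setICr setI0.
  by rewrite lebesgue_measure_set1 add0e.
rewrite -measureU//.
  apply: le_measure; rewrite ?inE//; first exact: measurableU.
    apply: compact_measurable; exact: compact_sumset.
  move=> x [|[]]; rewrite /A1/= mul1r.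
    by move=> Ax; exists (x - b) => //; exists b => //; rewrite subrK.
  by move=> Bx _; exists a => //; exists (x - a) => //; rewrite addrC subrK.
rewrite -subset0 => x []; rewrite /A1 /B1/= !mul1r => /maxa xba [/minb bxa] /eqP.
by apply/negP; rewrite negbK; apply/eqP; lra.
Qed.

(** A point is chosen in every A i, for i outside r too, so that choices are
    total functions. *)
Definition sumset_seq (I : Type) (r : seq I) (A : I -> set T) : set T :=
  [set x | exists2 t : I -> R, forall i, A i (t i) & x = \sum_(i <- r) t i].

Lemma lebesgue_sumset_seq (I : eqType) (r : seq I) (A : I -> set T) :
  uniq r -> (forall i, compact (A i)) -> (forall i, A i !=set0) ->
  compact (sumset_seq r A) /\ (\sum_(i <- r) leb (A i) <= leb (sumset_seq r A))%E.
Proof.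
move=> + cA A0; have [t0 At0] := choice A0.
elim: r => [_|i r IHr /= /andP[ir ur]].
  have -> : sumset_seq [::] A = [set 0].
    apply/seteqP; split => [x [t _ ->]|x ->] /=; first by rewrite big_nil.
    by exists t0 => //; rewrite big_nil.
  by split; [exact: compact_set1|rewrite big_nil measure_ge0].
have [cD leD] := IHr ur.
have -> : sumset_seq (i :: r) A = sumset (A i) (sumset_seq r A).
  apply/seteqP; split => [x [t At ->]|_ [y Ay [_ [t At ->] <-]]].
    by exists (t i) => //; exists (\sum_(j <- r) t j); rewrite ?big_cons//; exists t.
  exists (fun j => if j == i then y else t j).
    by move=> j; case: eqP => [->|].
  rewrite big_cons eqxx; congr (_ + _); apply: eq_big_seq => j jr.
  by case: eqP => // ji; rewrite -ji jr in ir.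
split; first exact: compact_sumset.
rewrite big_cons; apply: (@le_trans _ _ (leb (A i) + leb (sumset_seq r A))%E).
  by rewrite leeD2l.
apply: lebesgue_sumset => //.
by exists (\sum_(j <- r) t0 j); exists t0.
Qed.

(** The compact case passes to measurable sets by inner regularity. As a sum of
    measurable sets may fail to be measurable, it is replaced by a measurable
    set C that contains it. *)
Lemma brunn_minkowski_line (I : eqType) (r : seq I) (p : I -> R)
    (A : I -> set T) (C : set T) : uniq r -> (forall i, i \in r -> 0 < p i) ->
  (forall i, measurable (A i)) -> (forall i, (leb (A i) < +oo)%E) ->
  (forall i, A i !=set0) -> measurable C ->
  (forall t, (forall i, A i (t i)) -> C (\sum_(i <- r) p i * t i)) ->
  (\sum_(i <- r) (p i)%:E * leb (A i) <= leb C)%E.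
Proof.
move=> ur p0 mA foo A0 mC AC.
apply/lee_addgt0Pr => e e0.
pose s := 1 + \sum_(i <- r) p i.
have sr0 : 0 <= \sum_(i <- r) p i.
  by rewrite big_seq; apply: sumr_ge0 => i /p0/ltW.
have s0 : 0 < s by rewrite /s; lra.
have es : 0 < e / s by rewrite divr_gt0.
have /choice[V VP] i : exists V : set T,
    [/\ compact V, V `<=` A i, V !=set0 & (leb (A i) <= leb V + (e / s)%:E)%E].
  have [V [cV VA AV]] := lebesgue_regularity_inner (mA i) (foo i) es.
  have [a Aa] := A0 i; exists (V `|` [set a]).
  have cVa : compact (V `|` [set a]) by apply: compactU => //; exact: compact_set1.
  have mV : measurable V by exact: compact_measurable.
  split => //; first by move=> x [/VA//|->].
    by exists a; right.
  rewrite -(setIidr VA) in mV.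
  rewrite -{1}(setDKU VA) measureU//=; last 3 first.
    by apply: measurableD => //; exact: compact_measurable.
    by exact: compact_measurable.
    by rewrite setDE -setIA setICl setI0.
  rewrite addeC leeD//; last exact: ltW.
  by apply: le_measure; rewrite ?inE//; exact: compact_measurable.
pose B i : set T := if i \in r then [set x | V i ((p i)^-1 * x + 0)] else [set 0].
have BE i : i \in r -> B i = (fun x => p i * x) @` V i.
  move=> ir; rewrite /B ir; have pi0 := lt0r_neq0 (p0 _ ir).
  apply/seteqP; split => [x /=|_ [x Vx <-]] /=; rewrite addr0.
    by move=> Vx; exists ((p i)^-1 * x) => //; rewrite mulrA divff// mul1r.
  by rewrite mulrA mulVf// mul1r.
have cB i : compact (B i).
  have [ir|ir] := boolP (i \in r); last by rewrite /B (negbTE ir); exact: compact_set1.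
  rewrite BE//; apply: continuous_compact; last by have [] := VP i.
  by apply: continuous_subspaceT => x; exact: mulrl_continuous.
have B0 i : B i !=set0.
  have [ir|ir] := boolP (i \in r); last by rewrite /B (negbTE ir); exists 0.
  by rewrite BE//; have [_ _ [x Vx] _] := VP i; exists (p i * x); exists x.
have [cD leD] := lebesgue_sumset_seq ur cB B0.
apply: (@le_trans _ _ (\sum_(i <- r) leb (B i) + e%:E)%E); last first.
  rewrite leeD2r//; apply: le_trans leD _; apply: le_measure; rewrite ?inE//.
    exact: compact_measurable.
  move=> _ [t Bt ->].
  have /choice[u uP] i : exists u, A i u /\ (i \in r -> t i = p i * u).
    have [ir|ir] := boolP (i \in r); last by have [u Au] := A0 i; exists u.
    have := Bt i; rewrite BE// => -[u Vu <-]; exists u; split => //.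
    by have [_ + _ _] := VP i; apply.
  rewrite (eq_big_seq (fun i => p i * u i)); last by move=> i ir; have [_ ->] := uP i.
  by apply: AC => i; have [] := uP i.
apply: (@le_trans _ _ (\sum_(i <- r) (leb (B i) + (p i * (e / s))%:E))%E).
  rewrite big_seq [leRHS]big_seq; apply: lee_sum => i ir.
  have [cV _ _ leV] := VP i; have pi0 := p0 _ ir.
  apply: (@le_trans _ _ ((p i)%:E * (leb (V i) + (e / s)%:E))%E).
    by rewrite lee_pmul2l// lte_fin.
  rewrite muleDr//; last by rewrite ge0_adde_def// inE ?measure_ge0// lee_fin ltW.
  rewrite EFinM leeD2r//.
  rewrite /B ir lebesgue_measure_aff ?invr_neq0 ?gt_eqF//; last exact: compact_measurable.
  by rewrite gtr0_norm ?invr_gt0// invrK.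
rewrite big_split/= leeD2l// sumEFin lee_fin -mulr_suml mulrCA ger_pMr//.
by rewrite ler_pdivrMr// mul1r /s lerDr.
Qed.

End brunn_minkowski_line.

(** * The Prekopa-Leindler inequality on the line *)

Section layer_cake.
Context {R : realType}.
Local Notation leb := (@lebesgue_measure R).
Local Notation T := (measurableTypeR R).

Lemma measurable_ler_set d (X : measurableType d) (f g : X -> R) :
  measurable_fun setT f -> measurable_fun setT g ->
  measurable [set x | f x <= g x].
Proof.
move=> mf mg.
have := @measurable_lee _ X R setT measurableT (EFin \o f) (EFin \o g).
rewrite setTI; apply; exact/measurable_EFinP.
Qed.

(** When E is the region under the graph of a function, its horizontal sections
    are the superlevel sets; exchanging the integrals expresses the integral of
    the function through their measures. *)
Lemma layer_cake_weight d (X : measurableType d)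
    (mu : {sigma_finite_measure set X -> \bar R}) (w : R -> R) (E : set (X * T)) :
  (forall s, 0 <= w s) -> measurable_fun setT (w : T -> R) -> measurable E ->
  (\int[mu]_x \int[leb]_s ((w s)%:E * (\1_E (x, s))%:E) =
   \int[leb]_s ((w s)%:E * mu [set x | E (x, s)]))%E.
Proof.
move=> w0 mw mE.
have mf : measurable_fun setT
    (fun u : X * T => ((w u.2)%:E * (\1_E u)%:E)%E : \bar R).
  apply: emeasurable_funM.
    by apply/measurable_EFinP; apply: (measurableT_comp mw).
  by apply/measurable_EFinP; exact: measurable_indic.
rewrite (fubini_tonelli (m1 := mu) (m2 := leb) _ mf)/=; last first.
  by move=> u; rewrite mule_ge0// lee_fin.
apply: eq_integral => s _.
have mEs : measurable [set x | E (x, s)].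
  have := measurable_ysection s mE.
  by congr measurable; apply/seteqP; split => x /=; rewrite /ysection/= inE.
rewrite ge0_integralZl_EFin//.
  by congr (_ * _)%E; rewrite -[X in _ = mu X]setIT -integral_indic.
by apply/measurable_EFinP; apply: measurable_indic.
Qed.

Lemma measurable_level_measure (f : R -> R) : measurable_fun setT (f : T -> R) ->
  measurable_fun setT (fun s : T => leb [set x | (s <= f x)%R]).
Proof.
move=> mf; pose E : set (T * T) := [set u | u.2 <= f u.1].
have mE : measurable E.
  apply: (@measurable_ler_set _ (T * T)%type snd (f \o fst)); first exact: measurable_snd.
  by apply: measurableT_comp mf _; exact: measurable_fst.
have := measurable_fun_ysection leb mE.
congr measurable_fun; apply/funext => s /=; congr lebesgue_measure.
by apply/seteqP; split => x /=; rewrite /ysection/= inE.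
Qed.

Lemma layer_cake_unit (f : R -> R) : measurable_fun setT (f : T -> R) ->
  (forall x, 0 <= f x) ->
  (\int[leb]_(s in `]0%R, 1%R[) leb [set x | (s <= f x)%R] =
   \int[leb]_x (Num.min (f x) 1)%:E)%E.
Proof.
move=> mf f0.
pose E : set (T * T) := [set u | u.2 <= f u.1].
have mE : measurable E.
  apply: (@measurable_ler_set _ (T * T)%type snd (f \o fst)); first exact: measurable_snd.
  by apply: measurableT_comp mf _; exact: measurable_fst.
rewrite integral_mkcond.
transitivity (\int[leb]_s
    (((\1_(`]0, 1[%classic : set T) s)%:E : \bar R) * leb [set x | E (x, s)]))%E.
  apply: eq_integral => s _; rewrite patchE indicE.
  by case: ifPn => _; rewrite ?mul1e ?mul0e.
rewrite -(@layer_cake_weight _ T leb)//.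
apply: eq_integral => x _.
have m1 : measurable [set s : T | (s <= f x)%R].
  by rewrite (_ : mkset _ = `]-oo, f x]%classic).
transitivity (\int[leb]_s (\1_(`]0%R, 1%R[ `&` [set s : T | (s <= f x)%R]) s)%:E)%E.
  by apply: eq_integral => s _; rewrite indicI/= !indicE -EFinM.
rewrite integral_indic ?setIT//; last exact: measurableI.
have [f1|f1] := ltP (f x) 1.
  rewrite (_ : _ `&` _ = `]0, f x]%classic).
    rewrite [LHS]lebesgue_measure_itv/= lte_fin -EFinB subr0; case: ltP => // fx0.
    by have -> : f x = 0 by apply/eqP; rewrite eq_le f0 fx0.
  apply/seteqP; split => s /=; rewrite !in_itv/=.
    by move=> [/andP[-> _] ->].
  by move=> /andP[-> sf]; split => //=; exact: le_lt_trans f1.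
rewrite (_ : _ `&` _ = `]0, 1[%classic).
  by rewrite [LHS]lebesgue_measure_itv/= lte_fin ltr01 -EFinB subr0.
apply/seteqP; split => s /=; rewrite !in_itv/=; first by case.
by move=> /andP[-> s1]; split => //=; exact: le_trans (ltW s1) f1.
Qed.

End layer_cake.

Section prekopa_leindler.
Context {R : realType}.
Local Notation leb := (@lebesgue_measure R).
Local Notation T := (measurableTypeR R).

(** After rescaling, all the functions have supremum 1, so that every level in
    ]0, 1[ gives nonempty superlevel sets. Brunn-Minkowski compares the measures
    of these sets, the layer cake formula turns this into an inequality between
    integrals, and the weighted arithmetic-geometric inequality finishes. *)
Theorem prekopa_leindler (I : eqType) (r : seq I) (p : I -> R)
    (f : I -> R -> R) (h : R -> R) (M F : I -> R) :
  uniq r -> (forall i, 0 < p i) -> \sum_(i <- r) p i = 1 ->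
  (forall i, measurable_fun setT (f i : T -> R)) ->
  (forall i x, 0 <= f i x <= M i) ->
  (forall i, (\int[leb]_x (f i x)%:E)%E = (F i)%:E) ->
  measurable_fun setT (h : T -> R) -> (forall x, 0 <= h x) ->
  (forall t, \prod_(i <- r) f i (t i) `^ p i <= h (\sum_(i <- r) p i * t i)) ->
  ((\prod_(i <- r) F i `^ p i)%:E <= \int[leb]_x (h x)%:E)%E.
Proof.
move=> ur p0 p1 mf fM fF mh h0 fh.
have f0 i x : 0 <= f i x by have /andP[] := fM i x.
have F0 i : 0 <= F i.
  by rewrite -lee_fin -fF; apply: integral_ge0 => x _; rewrite lee_fin.
have [/hasP[i ir /eqP Fi]|/hasPn Fneq] := boolP (has (fun i => F i == 0) r).
  rewrite (big_rem i)//= Fi powR0 ?mul0r; last by rewrite gt_eqF// p0.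
  by apply: integral_ge0 => x _; rewrite lee_fin.
have Fpos i : i \in r -> 0 < F i by move=> /Fneq; rewrite lt0r F0 andbT.
pose m i := sup (range (f i)).
have hs i : has_sup (range (f i)).
  by split; [exists (f i 0); exists 0|exists (M i) => _ [x _ <-]; have /andP[] := fM i x].
have fm i x : f i x <= m i by apply: ub_le_sup; [case: (hs i)|exists x].
have mpos i : i \in r -> 0 < m i.
  move=> ir; rewrite lt_neqAle (le_trans (f0 i 0) (fm i 0)) andbT.
  apply/eqP => m0; have := Fpos _ ir.
  have : (F i)%:E = 0%E.
    rewrite -fF integral0_eq// => x _; congr EFin.
    by apply/eqP; rewrite eq_le f0 andbT m0 fm.
  by move=> [->]; rewrite ltxx.
pose c := \prod_(i <- r) m i `^ p i.
have c0 : 0 < c by rewrite /c big_seq; apply: prodr_gt0 => i ir; exact/powR_gt0/mpos.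
(* indices outside r get a constant function, which always has a point at level s *)
pose g i x := if i \in r then f i x / m i else 0.
have mg i : measurable_fun setT (g i : T -> R).
  rewrite /g; case: (i \in r); last exact: measurable_cst.
  exact: measurable_funM.
have g0 i x : 0 <= g i x.
  by rewrite /g; case: ifPn => // ir; rewrite divr_ge0// ltW// mpos.
have g1 i x : g i x <= 1.
  by rewrite /g; case: ifPn => // ir; rewrite ler_pdivrMr ?mul1r ?fm ?mpos.
have gF i : i \in r -> (\int[leb]_x (g i x)%:E = (F i / m i)%:E)%E.
  move=> ir; rewrite /g ir; under eq_integral do rewrite mulrC EFinM.
  rewrite (@ge0_integralZl_EFin _ _ _ leb setT measurableT (fun x => (f i x)%:E))//.
  - by rewrite fF -EFinM mulrC.
  - by move=> x _; rewrite lee_fin.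
  - exact/measurable_EFinP.
  - by rewrite invr_ge0 ltW// mpos.
pose k x := h x / c.
have mk : measurable_fun setT (k : T -> R) by exact: measurable_funM.
have k0 x : 0 <= k x by rewrite divr_ge0// ltW.
have level (U : R -> R) (s : R) : measurable_fun setT (U : T -> R) -> measurable [set x : T | (s <= U x)%R].
  by move=> mU; apply: (@measurable_ler_set R _ T (cst s) U).
(* the superlevel set of k at s contains the weighted sum of those of the g i *)
have kge s : s \in `]0%R, 1%R[%classic ->
    (\sum_(i <- r) (p i)%:E * leb [set x | (s <= g i x)%R] <= leb [set x | (s <= k x)%R])%E.
  rewrite inE/= in_itv/= => /andP[s0 s1].
  pose A i : set T := if i \in r then [set x | (s <= g i x)%R] else [set 0].
  rewrite [leLHS](eq_big_seq (fun i => ((p i)%:E * leb (A i))%E)); last first.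
    by move=> i ir; rewrite /A ir.
  apply: brunn_minkowski_line => //.
  - by move=> i; rewrite /A; case: ifP => _; [exact: level|exact: measurable_set1].
  - move=> i; rewrite /A; case: ifPn => ir; last by rewrite lebesgue_measure_set1.
    have sgF : (s%:E * leb [set x | (s <= g i x)%R] <= (F i / m i)%:E)%E.
      have -> : leb [set x | (s <= g i x)%R] = (\int[leb]_x (\1_[set x : T | (s <= g i x)%R] x)%:E)%E.
        by rewrite integral_indic ?setIT//; exact: level.
      rewrite -gF// -ge0_integralZl_EFin//; last 2 first.
        by apply/measurable_EFinP; apply: measurable_indic; exact: level.
        exact: ltW.
      apply: ge0_le_integral => //.
      - by move=> x _; rewrite -EFinM lee_fin mulr_ge0// ltW.
      - apply/measurable_EFinP; apply: measurable_funM => //.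
        by apply: measurable_indic; exact: level.
      - exact/measurable_EFinP.
      move=> x _; rewrite -EFinM lee_fin indicE.
      by have [/set_mem|_] := boolP (x \in _); rewrite ?mulr1 ?mulr0.
    rewrite ltey; apply/eqP => lebE; move: sgF; rewrite lebE gt0_muley ?lte_fin//.
  - move=> i; rewrite /A; case: ifPn => ir; last by exists 0.
    have : s * m i < m i by rewrite gtr_pMl ?mpos.
    move=> /(sup_gt (proj1 (hs i))) [_ [x _ <-] sf]; exists x.
    by rewrite /= /g ir ler_pdivlMr ?mpos// ltW.
  - exact: level.
  move=> t At /=.
  rewrite /k ler_pdivlMr//; apply: le_trans (fh _).
  rewrite {1}(_ : s = \prod_(i <- r) s `^ p i); last by rewrite -powR_sum// p1 powRr1// ltW.
  rewrite -big_split/=.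
  rewrite [leLHS]big_seq [leRHS]big_seq; apply: ler_prod => i ir.
  rewrite -powRM ?(ltW s0)// ?(ltW (mpos _ ir))// powR_ge0/=.
  have := At i; rewrite /A ir /= /g ir ler_pdivlMr ?mpos// => sm.
  apply: ge0_ler_powR => //; rewrite ?nnegrE//; first exact/ltW.
  by rewrite mulr_ge0// ltW// mpos.
have gk : ((\sum_(i <- r) p i * (F i / m i))%:E <= \int[leb]_x (k x)%:E)%E.
  apply: (@le_trans _ _ (\int[leb]_(s in `]0%R, 1%R[) leb [set x | (s <= k x)%R])%E).
    apply: (@le_trans _ _ (\int[leb]_(s in `]0%R, 1%R[)
        \sum_(i <- r) ((p i)%:E * leb [set x | (s <= g i x)%R]))%E).
      rewrite ge0_integral_sum//; last 2 first.
        by move=> i; apply: measurable_funeM; apply: measurable_funTS; exact: measurable_level_measure.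
        by move=> i s _; rewrite mule_ge0// lee_fin ltW.
      rewrite [leRHS](eq_big_seq (fun i => (p i * (F i / m i))%:E)); first by rewrite sumEFin.
      move=> i ir; rewrite ge0_integralZl_EFin//; last 2 first.
        by apply: measurable_funTS; exact: measurable_level_measure.
        exact/ltW.
      rewrite layer_cake_unit// EFinM -gF//; congr (_ * _)%E.
      by apply: eq_integral => x _; rewrite min_l.
    apply: ge0_le_integral => //.
    - by move=> s _; apply: sume_ge0 => i _; rewrite mule_ge0// lee_fin ltW.
    - apply: emeasurable_sum => i; apply: measurable_funeM; apply: measurable_funTS.
      exact: measurable_level_measure.
    - by apply: measurable_funTS; exact: measurable_level_measure.
    - by move=> s s01; apply: kge; rewrite inE.
  rewrite layer_cake_unit//; apply: ge0_le_integral => //.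
  - by move=> x _; rewrite lee_fin le_min k0 ler01.
  - by apply/measurable_EFinP; exact: measurable_minr.
  - exact/measurable_EFinP.
  - by move=> x _; rewrite lee_fin ge_min lexx.
have -> : \prod_(i <- r) F i `^ p i = c * \prod_(i <- r) (F i / m i) `^ p i.
  rewrite -big_split/=; apply: eq_big_seq => i ir.
  rewrite -powRM ?divr_ge0 ?(ltW (mpos _ ir))//.
  by rewrite mulrCA divff ?mulr1// gt_eqF// mpos.
have -> : (\int[leb]_x (h x)%:E = c%:E * \int[leb]_x (k x)%:E)%E.
  rewrite -ge0_integralZl_EFin//; [|by move=> x _; rewrite lee_fin|exact/measurable_EFinP|exact: ltW].
  by apply: eq_integral => x _; rewrite -EFinM /k mulrCA divff ?mulr1// gt_eqF.
rewrite EFinM lee_pmul2l ?lte_fin//; apply: le_trans gk; rewrite lee_fin.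
apply: weighted_AM_GM => // i; rewrite divr_ge0//.
by apply: le_trans (fm i 0).
Qed.

End prekopa_leindler.

(** * Integration over coordinate subspaces *)

Section reverse_finner.
Context {R : realType}.
Local Notation leb := (@lebesgue_measure R).
Local Notation T := (measurableTypeR R).
Variables (q : R -> R) (Q : R).
Hypothesis mq : measurable_fun setT (q : T -> R).
Hypothesis q0 : forall t, 0 <= q t.
Hypothesis q1 : forall t, q t <= 1.
Hypothesis intq : (\int[leb]_t (q t)%:E = Q%:E)%E.

(** Domination by a product of integrable functions of one variable keeps all
    the iterated integrals below finite and all the marginals bounded. *)
Definition dominated n (f : n.-tuple T -> R) :=
  [/\ measurable_fun setT f, (forall x, 0 <= f x) &
      exists2 M, 0 <= M & forall x, f x <= M * \prod_(i < n) q (tnth x i)].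

Definition marginal n (b : bool) (f : n.+1.-tuple T -> R) (x : n.-tuple T) : R :=
  if b then fine (\int[leb]_t (f [tuple of t :: x])%:E)%E else f [tuple of (0 : T) :: x].

(** The iterated integral over the coordinate subspace spanned by the i with
    b i: a coordinate outside of it is set to 0. The first coordinate is
    integrated innermost, so that removing it is a marginal, to which induction
    on the dimension applies. *)
Fixpoint coord_integral n : ('I_n -> bool) -> (n.-tuple T -> R) -> R :=
  match n with
  | 0 => fun _ f => f [tuple]
  | k.+1 => fun b f => coord_integral (fun i => b (lift ord0 i)) (marginal (b ord0) f)
  end.

Lemma dominated_cons n (f : n.+1.-tuple T -> R) : dominated f ->
  exists2 M, 0 <= M & forall t (x : n.-tuple T),
    f [tuple of t :: x] <= M * (q t * \prod_(i < n) q (tnth x i)).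
Proof.
move=> [_ _ [M M0 fM]]; exists M => // t x; apply: le_trans (fM _) _.
rewrite big_ord_recl tnth0 ler_wpM2l// ler_wpM2l//.
by under eq_bigr do rewrite tnthS.
Qed.

Lemma prod_q_ge0 n (x : n.-tuple T) : 0 <= \prod_(i < n) q (tnth x i).
Proof. by apply: prodr_ge0. Qed.

Lemma measurable_section n (f : n.+1.-tuple T -> R) (x : n.-tuple T) :
  dominated f -> measurable_fun setT (fun t : T => f [tuple of t :: x]).
Proof.
move=> [mf _ _]; apply: (measurableT_comp mf).
by apply: measurable_cons => //; exact: measurable_cst.
Qed.

Lemma marginalE n (f : n.+1.-tuple T -> R) (x : n.-tuple T) : dominated f ->
  (\int[leb]_t (f [tuple of t :: x])%:E = (marginal true f x)%:E)%E.
Proof.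
move=> df; rewrite fineK//; have [M M0 fM] := dominated_cons df.
have [_ f0 _] := df.
rewrite ge0_fin_numE; last by apply: integral_ge0 => t _; rewrite lee_fin.
apply: (@le_lt_trans _ _ (\int[leb]_t ((M * \prod_(i < n) q (tnth x i))%:E * (q t)%:E))%E).
  apply: ge0_le_integral => //.
  - by move=> t _; rewrite lee_fin.
  - by apply/measurable_EFinP; exact: measurable_section.
  - by apply: measurable_funeM; exact/measurable_EFinP.
  - by move=> t _; rewrite -EFinM lee_fin (le_trans (fM t x))// -mulrA [_ * q t]mulrC.
rewrite ge0_integralZl_EFin//.
- by rewrite intq ltry.
- by move=> t _; rewrite lee_fin.
- exact/measurable_EFinP.
- by rewrite mulr_ge0// prod_q_ge0.
Qed.

Lemma Q_ge0 : 0 <= Q.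
Proof. by rewrite -lee_fin -intq; apply: integral_ge0 => t _; rewrite lee_fin. Qed.

Lemma dominated_marginal n (b : bool) (f : n.+1.-tuple T -> R) :
  dominated f -> dominated (marginal b f).
Proof.
move=> df; have [mf f0 _] := df; have [M M0 fM] := dominated_cons df.
case: b; split.
- pose g (u : T * n.-tuple T) : \bar R := (f (Defs.cons_tuple u))%:E.
  have mg : measurable_fun setT g.
    by apply/measurable_EFinP; apply: (measurableT_comp mf); exact: measurable_cons_tuple.
  apply/measurable_EFinP.
  rewrite (_ : _ \o _ = fubini_G leb g); last first.
    by apply/funext => x; rewrite /= -marginalE.
  by apply: measurable_fun_fubini_tonelli_G => // u; rewrite lee_fin.
- by move=> x; rewrite fine_ge0//; apply: integral_ge0 => t _; rewrite lee_fin.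
- exists (M * Q); first by rewrite mulr_ge0// Q_ge0.
  move=> x; rewrite -lee_fin -marginalE// mulrAC EFinM -intq.
  rewrite -ge0_integralZl_EFin//; last 3 first.
  + by move=> t _; rewrite lee_fin.
  + exact/measurable_EFinP.
  + by rewrite mulr_ge0// prod_q_ge0.
  apply: ge0_le_integral => //.
  + by move=> t _; rewrite lee_fin.
  + by apply/measurable_EFinP; exact: measurable_section.
  + by apply: measurable_funeM; exact/measurable_EFinP.
  + by move=> t _; rewrite -EFinM lee_fin (le_trans (fM t x))// -mulrA [_ * q t]mulrC.
- apply: (measurableT_comp mf).
  by apply: measurable_cons => //; exact: measurable_cst.
- by move=> x; exact: f0.
- exists M => // x; apply: le_trans (fM _ _) _.
  by rewrite ler_wpM2l// ler_piMl// prod_q_ge0.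
Qed.

Lemma integral_cons_tuple n (f : n.+1.-tuple T -> R) :
  measurable_fun setT f -> (forall x, 0 <= f x) ->
  (\int[@lebesgue_tuple R n.+1]_x (f x)%:E =
   \int[@lebesgue_tuple R n]_x \int[leb]_t (f [tuple of t :: x])%:E)%E.
Proof.
move=> mf f0; have mc := @measurable_cons_tuple R n.
rewrite /= ge0_integral_pushforward//=; last 2 first.
  exact/measurable_EFinP.
  by move=> x _; rewrite lee_fin.
rewrite preimage_setT.
have mg : measurable_fun setT (fun u : T * n.-tuple T => (f (Defs.cons_tuple u))%:E).
  by apply/measurable_EFinP; exact: measurableT_comp.
rewrite (fubini_tonelli2 (m1 := leb) (m2 := @lebesgue_tuple R n) _ mg)//.
by move=> u; rewrite lee_fin.
Qed.

Lemma coord_integral_full n (f : n.-tuple T -> R) : dominated f ->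
  (\int[@lebesgue_tuple R n]_x (f x)%:E = (coord_integral (fun=> true) f)%:E)%E.
Proof.
elim: n f => [|n IHn] f df; last first.
  have [mf f0 _] := df; rewrite integral_cons_tuple//.
  under eq_integral do rewrite marginalE//.
  by rewrite IHn//; exact: dominated_marginal.
have [mf _ _] := df.
rewrite /= integral_dirac//; last exact/measurable_EFinP.
by rewrite diracE mem_set// mul1e.
Qed.

(** The coordinates are integrated out one at a time. Along each of them only
    the functions whose index set contains that coordinate depend on it, and
    the weights of these sum to 1, as required by the inequality on the line. *)
Theorem reverse_finner n m (b : 'I_m -> 'I_n -> bool) (p : 'I_m -> R)
    (f : 'I_m -> n.-tuple T -> R) (h : n.-tuple T -> R) :
  (forall j, 0 < p j) -> (forall i, \sum_(j < m) p j * (b j i)%:R = 1) ->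
  (forall j, dominated (f j)) -> dominated h ->
  (forall x : 'I_m -> n.-tuple T, (forall j i, ~~ b j i -> tnth (x j) i = 0) ->
    \prod_(j < m) f j (x j) `^ p j <=
    h [tuple (\sum_(j < m) p j * tnth (x j) i : T) | i < n]) ->
  \prod_(j < m) coord_integral (b j) (f j) `^ p j <= coord_integral (fun=> true) h.
Proof.
move=> p0.
elim: n b f h => [|n IHn] b f h pb df dh fh.
  by apply: le_trans (fh (fun=> [tuple]) _) _ => [j []//|]; rewrite tuple0.
apply: IHn => [i|j||x xb].
- exact: pb.
- exact: dominated_marginal.
- exact: dominated_marginal.
rewrite (bigID (fun j => b j ord0))/=.
set c := \prod_(j < m | ~~ b j ord0) _.
have mh0 y : 0 <= marginal true h y.
  by have [_ + _] := dominated_marginal true dh; apply.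
have c_ge0 : 0 <= c by rewrite /c; apply: prodr_ge0 => j _; exact: powR_ge0.
have [cE|c_neq0] := eqVneq c 0; first by rewrite cE mulr0; exact: mh0.
have c0 : 0 < c by rewrite lt0r c_ge0 andbT.
rewrite -ler_pdivlMr// -lee_fin.
set z := [tuple _ | i < n].
have [mh h0 _] := dh.
have -> : (marginal true h z / c)%:E = (\int[leb]_t (h [tuple of t :: z] / c)%:E)%E.
  under eq_integral do rewrite mulrC EFinM.
  rewrite (@ge0_integralZl_EFin _ _ _ leb setT measurableT (fun t => (h [tuple of t :: z])%:E))//.
  - by rewrite marginalE// -EFinM mulrC.
  - by move=> t _; rewrite lee_fin.
  - by apply/measurable_EFinP; exact: measurable_section.
  - by rewrite invr_ge0 ltW.
rewrite -big_filter; set r := [seq j <- _ | _].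
have rE j : j \in r = b j ord0 by rewrite mem_filter mem_index_enum andbT.
have /choice[M fM] j : exists M, forall t, 0 <= f j [tuple of t :: x j] <= M.
  have [M M0 fM] := dominated_cons (df j); have [_ f0 _] := df j.
  exists M => t; rewrite f0/=; apply: le_trans (fM _ _) _.
  rewrite ler_piMr// mulr_ile1 ?prod_q_ge0//.
  by apply: prodr_ile1 => i _; rewrite q0 q1.
rewrite (eq_big_seq (fun j => marginal true (f j) (x j) `^ p j)); last first.
  by move=> j; rewrite rE => ->.
apply: (@prekopa_leindler R _ r p (fun j t => f j [tuple of t :: x j])
  (fun t => h [tuple of t :: z] / c) M (fun j => marginal true (f j) (x j))) => //.
- by rewrite filter_uniq// index_enum_uniq.
- rewrite big_filter -[RHS](pb ord0) big_mkcond; apply: eq_bigr => j _.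
  by case: (b j ord0); rewrite ?mulr1 ?mulr0.
- by move=> j; exact: measurable_section.
- by move=> j; exact: marginalE.
- by apply: measurable_funM => //; exact: measurable_section.
- by move=> t; rewrite divr_ge0// ltW.
move=> t; rewrite ler_pdivlMr//.
pose s j : T := if b j ord0 then t j else 0.
have := fh (fun j => [tuple of s j :: x j]).
rewrite (bigID (fun j => b j ord0))/= => H.
have -> : c = \prod_(j < m | ~~ b j ord0) f j [tuple of s j :: x j] `^ p j.
  by apply: eq_bigr => j bj; rewrite /marginal /s (negbTE bj).
rewrite big_filter [X in X * _](_ : _ = \prod_(j < m | b j ord0) f j [tuple of s j :: x j] `^ p j); last first.
  by apply: eq_bigr => j bj; rewrite /s bj.
apply: le_trans (H _) _.
  move=> j i; case: (unliftP ord0 i) => [k ->|->]; first by rewrite tnthS; exact: xb.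
  by rewrite tnth0 /s => /negbTE ->.
rewrite le_eqVlt; apply/orP; left; apply/eqP; congr h.
apply/eq_from_tnth => i; rewrite tnth_mktuple.
case: (unliftP ord0 i) => [k ->|->].
  by rewrite !tnthS tnth_mktuple; apply: eq_bigr => j _; rewrite tnthS.
rewrite tnth0 big_filter [RHS]big_mkcond; apply: eq_bigr => j _.
by rewrite tnth0 /s; case: (b j ord0); rewrite ?mulr0.
Qed.

End reverse_finner.

(** * The Gamma integral at integers *)

Section gamma_integral.
Context {R : realType}.
Local Notation leb := (@lebesgue_measure R).
Local Notation T := (measurableTypeR R).

(** The polynomial P with P - P' = X ^ n, which makes - P (t) exp (- t) a
    primitive of t ^ n exp (- t). *)
Fixpoint gamma_poly n : {poly R} :=
  if n is k.+1 then (k.+1%:R)%:P * gamma_poly k + 'X^(k.+1) else 1.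

Lemma gamma_polyB n : gamma_poly n - (gamma_poly n)^`() = 'X^n.
Proof.
elim: n => [|n IHn]; first by rewrite /= -[1]/(1%:P) derivC subr0 expr0.
rewrite /= derivD derivM derivC mul0r add0r derivXn opprD addrACA -mulrBr IHn.
by rewrite polyC_natr mulr_natl addrCA subrr addr0.
Qed.

Lemma cvg_exprn_expRN n : t ^+ n * expR (- t) @[t --> +oo] --> (0 : R).
Proof.
apply/cvgrPdist_le => e e0; near=> t.
have t0 : 0 < t by near: t; exact: nbhs_pinfty_gt.
have te : (n.+1)`!%:R / e <= t by near: t; apply: nbhs_pinfty_ge; exact: num_real.
rewrite sub0r normrN ger0_norm; last by rewrite mulr_ge0 ?exprn_ge0 ?expR_ge0// ltW.
have f0 : 0 < (n.+1)`!%:R :> R by rewrite ltr0n fact_gt0.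
have := expR_ge1Dxn n (ltW t0); rewrite -[t ^+ n.+1]/(t ^+ n.+1) exprS => h.
rewrite expRN ler_pdivrMr ?expR_gt0//.
apply: (@le_trans _ _ (e * (t * t ^+ n / (n.+1)`!%:R))).
  rewrite mulrA ler_pdivlMr// mulrA [leLHS]mulrC ler_wpM2r ?exprn_ge0 ?(ltW t0)//.
  by rewrite -ler_pdivrMl// mulrC.
rewrite ler_pM2l//; apply: le_trans h; lra.
Unshelve. all: by end_near. Qed.

Lemma gamma_poly0 n : (gamma_poly n).[0] = n`!%:R.
Proof.
elim: n => [|n IHn]; first by rewrite hornerC.
by rewrite /= hornerD hornerCM IHn hornerXn expr0n/= addr0 factS natrM.
Qed.

Lemma cvg_gamma_poly n : (gamma_poly n).[t] * expR (- t) @[t --> +oo] --> (0 : R).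
Proof.
elim: n => [|n IHn].
  rewrite (_ : (fun t : R => _) = fun t => t ^+ 0 * expR (- t)).
    exact: cvg_exprn_expRN.
  by apply/funext => t; rewrite /= hornerC expr0.
rewrite (_ : (fun t : R => _) =
  fun t => n.+1%:R * ((gamma_poly n).[t] * expR (- t)) + t ^+ n.+1 * expR (- t)).
  rewrite -[X in _ --> X]addr0 -[X in _ --> X + _](mulr0 n.+1%:R).
  by apply: cvgD (cvg_exprn_expRN n.+1); apply: cvgM IHn; exact: cvg_cst.
by apply/funext => t /=; rewrite hornerD hornerCM hornerXn mulrDl mulrA.
Qed.

Lemma is_derive_expRN t : is_derive t (1 : R) (fun s => expR (- s)) (- expR (- t)).
Proof.
have dN : derivable (fun s : R => - s) t 1 by exact: derivableN.
have dE : derivable (@expR R) (- t) 1 by apply: ex_derive; exact: is_derive_expR.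
apply: DeriveDef.
  by apply/derivable1_diffP; apply: differentiable_comp; exact/derivable1_diffP.
rewrite -derive1E (derive1_comp dN dE) !derive1E.
have /funeqP -> := @derive_expR R.
by rewrite deriveN// derive_id mulrN1.
Qed.

Lemma continuous_expRN : continuous (fun t : R => expR (- t)).
Proof.
by move=> t; apply: continuous_comp; [exact: opp_continuous|exact: continuous_expR].
Qed.

Lemma integral_expRN_tail (s : R) :
  (\int[leb]_(t in `[s, +oo[) (expR (- t))%:E = (expR (- s))%:E)%E.
Proof.
have dF t : is_derive t (1 : R) (fun t => - expR (- t)) (expR (- t)).
  by have := is_deriveN (is_derive_expRN t); rewrite opprK.
rewrite (@ge0_continuous_FTC2y R (fun t => expR (- t)) (fun t => - expR (- t)) s 0).
- by rewrite EFinN oppeK add0e.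
- by move=> t _; exact: expR_ge0.
- by apply: continuous_subspaceT; exact: continuous_expRN.
- by rewrite -oppr0; apply: cvgN; exact: cvgr_expR.
- by move=> t _; apply: ex_derive; exact: dF.
- by apply/cvg_at_right_filter; apply: cvgN; exact: continuous_expRN.
- by move=> t _; rewrite derive1E; apply: derive_val; exact: dF.
Qed.

Lemma integral_exprn_expRN n :
  (\int[leb]_(t in `[0%R, +oo[) (t ^+ n * expR (- t))%:E = (n`!%:R)%:E)%E.
Proof.
pose F t := - ((gamma_poly n).[t] * expR (- t)).
have dF t : is_derive t (1 : R) F (t ^+ n * expR (- t)).
  have d2 := is_deriveN (is_deriveM (is_derive_poly (gamma_poly n) t) (is_derive_expRN t)).
  apply: is_derive_eq d2 _.
  have := congr1 (horner^~ t) (gamma_polyB n); rewrite hornerD hornerN hornerXn => <-.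
  rewrite /GRing.scale/=; ring.
rewrite (@ge0_continuous_FTC2y R (fun t => t ^+ n * expR (- t)) F 0 0).
- by rewrite /F oppr0 expR0 mulr1 gamma_poly0 EFinN oppeK add0e.
- by move=> t t0; rewrite mulr_ge0 ?exprn_ge0 ?expR_ge0.
- apply: continuous_subspaceT => t; apply: cvgM; first exact: exprn_continuous.
  exact: continuous_expRN.
- by rewrite -oppr0; apply: cvgN; exact: cvg_gamma_poly.
- by move=> t _; apply: ex_derive; exact: dF.
- apply/cvg_at_right_filter; apply: differentiable_continuous.
  by apply/derivable1_diffP; apply: ex_derive; exact: dF.
- by move=> t _; rewrite derive1E; apply: derive_val; exact: dF.
Qed.

End gamma_integral.

(** * The exponential of minus the gauge of a convex body *)

Section exp_gauge.
Context {R : realType}.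
Local Notation leb := (@lebesgue_measure R).
Local Notation T := (measurableTypeR R).

Lemma measurable_box n (A : 'I_n -> set T) : (forall i, measurable (A i)) ->
  measurable [set t : n.-tuple T | forall i, A i (tnth t i)].
Proof.
move=> mA.
rewrite (_ : mkset _ = \big[setI/setT]_(i < n) ((fun t => tnth t i) @^-1` A i)).
  apply: bigsetI_measurable => i _; rewrite -[X in measurable X]setTI.
  exact: measurable_tnth.
apply/seteqP; split=> t /=; rewrite -bigcap_seq => At i; first by move=> _; exact: At.
by apply: (At i); rewrite /= mem_index_enum.
Qed.

(** The properties of a compact convex set containing the origin that the
    gauge needs. Closedness is only required along rays, so that the whole
    notion is visibly stable under injective linear preimages. *)
Record radial_body n (K : set 'rV[R]_n) : Prop := RadialBody {
  radial_measurable : row_measurable K;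
  radial_bounded : exists2 r, 0 < r & forall x, K x -> forall i, `|x 0 i| <= r;
  radial_convex : forall x y t, K x -> K y -> 0 <= t <= 1 ->
    K (t *: x + (1 - t) *: y);
  radial_closed : forall x, (forall s, 0 <= s < 1 -> K (s *: x)) -> K x;
  radial_origin : K 0
}.

Lemma radial_body_preimage k n (G : 'M[R]_(k, n)) (K : set 'rV[R]_n) :
  row_free G -> radial_body K -> radial_body [set x | K (x *m G)].
Proof.
move=> /row_freeP[B GB] [mK [r r0 Kr] cvx rad K0]; split => /=.
- exact: row_measurable_mul.
- exists (r * (1 + \sum_i \sum_j `|B i j|)).
    by rewrite mulr_gt0// ltr_wpDr// sumr_ge0// => i _; rewrite sumr_ge0.
  move=> x /Kr xr i.
  have -> : x = x *m G *m B by rewrite -mulmxA GB mulmx1.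
  rewrite mxE; apply: le_trans (ler_norm_sum _ _ _) _.
  rewrite mulrDr mulr1 ler_wpDl//; first exact: ltW.
  rewrite mulr_sumr; apply: ler_sum => l _; rewrite normrM.
  apply: ler_pM => //; rewrite (bigD1 i)//= lerDl; exact: sumr_ge0.
- by move=> x y t Kx Ky t01; rewrite mulmxDl -!scalemxAl; exact: cvx.
- by move=> x Kx; apply: rad => s s01; rewrite scalemxAl; exact: Kx.
- by rewrite mul0mx.
Qed.

Definition dilate n (K : set 'rV[R]_n) (t : R) : set 'rV[R]_n :=
  [set t *: x | x in K].

Lemma dilateE n (K : set 'rV[R]_n) (t : R) x : 0 < t ->
  dilate K t x <-> K (t^-1 *: x).
Proof.
move=> t0; have t1 := lt0r_neq0 t0; split=> [[y Ky <-]|Kx].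
  by rewrite scalerA mulVf// scale1r.
by exists (t^-1 *: x) => //; rewrite scalerA divff// scale1r.
Qed.

Variable n : nat.
Variable K : set 'rV[R]_n.
Hypothesis bK : radial_body K.

Lemma dilateD s t x y : 0 <= s -> 0 <= t ->
  dilate K s x -> dilate K t y -> dilate K (s + t) (x + y).
Proof.
move=> s0 t0 [x' Kx <-] [y' Ky <-].
have [st0|st0] := eqVneq (s + t) 0.
  have -> : s = 0 by lra.
  have -> : t = 0 by lra.
  by exists 0; [exact: radial_origin|rewrite addr0 !scale0r addr0].
have stp : 0 < s + t by rewrite lt0r st0 addr_ge0.
exists ((s / (s + t)) *: x' + (1 - s / (s + t)) *: y').
  apply: radial_convex => //; rewrite divr_ge0 ?(ltW stp)//= ler_pdivrMr// mul1r.
  by rewrite lerDl.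
rewrite scalerDr !scalerA mulrCA divff// mulr1; congr (_ *: _ + _ *: _).
by rewrite mulrBr mulr1 mulrCA divff// mulr1 addrAC subrr add0r.
Qed.

Lemma dilateM (p : R) t x : dilate K t x -> dilate K (p * t) (p *: x).
Proof. by move=> [y Ky <-]; exists y => //; rewrite scalerA. Qed.

Lemma dilate_le s t x : 0 <= s -> s <= t -> dilate K s x -> dilate K t x.
Proof.
move=> s0 st Kx; rewrite -(subrK s t) -[x]add0r; apply: dilateD => //.
  by rewrite subr_ge0.
by exists 0; [exact: radial_origin|rewrite scaler0].
Qed.

(** This is exp (- g) for the gauge g x = min {t >= 0 | x in t K}, and 0 at the
    points that lie in no dilate of K. *)
Definition exp_gauge (x : 'rV[R]_n) : R :=
  sup [set expR (- t) | t in [set t | 0 <= t /\ dilate K t x]].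

Let levels x := [set expR (- t) | t in [set t | 0 <= t /\ dilate K t x]].

Let levels_ub x : has_ubound (levels x).
Proof. by exists 1 => _ [t [t0 _] <-]; rewrite -expR0 ler_expR oppr_le0. Qed.

Lemma exp_gauge_ge0 x : 0 <= exp_gauge x.
Proof.
have [[y Sy]|S0] := pselect (levels x !=set0); last first.
  rewrite /exp_gauge -/(levels x).
  have -> : levels x = set0 by apply/seteqP; split => // y Sy; case: S0; exists y.
  by rewrite sup0.
apply: le_trans (ub_le_sup (levels_ub x) Sy).
by case: Sy => t _ <-; exact: expR_ge0.
Qed.

Lemma exp_gauge_le1 x : exp_gauge x <= 1.
Proof.
have [S0|S0] := pselect (levels x !=set0).
  by apply: ge_sup => // _ [t [t0 _] <-]; rewrite -expR0 ler_expR oppr_le0.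
rewrite /exp_gauge -/(levels x).
have -> : levels x = set0 by apply/seteqP; split => // y Sy; case: S0; exists y.
by rewrite sup0.
Qed.

(** The supremum is attained: by closedness along the ray through x if t > 0,
    and by boundedness, which forces x = 0, if t = 0. *)
Lemma exp_gaugeP x t : 0 <= t -> (expR (- t) <= exp_gauge x) <-> dilate K t x.
Proof.
move=> t0; split=> [tx|Kx]; last first.
  by apply: ub_le_sup; [exact: levels_ub|exists t].
have Sx : levels x !=set0.
  apply/not_existsP => S0; move: tx; rewrite /exp_gauge -/(levels x).
  have -> : levels x = set0 by apply/seteqP; split => // y /S0.
  by rewrite sup0 leNgt expR_gt0.
have above u : t < u -> dilate K u x.
  move=> tu; have : expR (- u) < exp_gauge x.
    by apply: lt_le_trans tx; rewrite ltr_expR ltrN2.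
  move=> /(sup_gt Sx)[_ [v [v0 Kv] <-]]; rewrite ltr_expR ltrN2 => vu.
  exact: dilate_le (ltW vu) Kv.
have := t0; rewrite le_eqVlt => /predU1P[te|tp].
  rewrite -te in above *.
  suff -> : x = 0 by exists 0; [exact: radial_origin|rewrite scaler0].
  apply/rowP => i; rewrite mxE; apply/eqP; rewrite -normr_le0.
  have [r r0 Kr] := radial_bounded bK.
  apply/ler_addgt0Pr => e e0; rewrite add0r.
  have er : 0 < e / r by rewrite divr_gt0.
  have /above[y Ky <-] := er; rewrite mxE normrM (gtr0_norm er).
  by rewrite -[leRHS](divfK (lt0r_neq0 r0)) ler_wpM2l ?(ltW er)// Kr.
apply/dilateE => //; apply: radial_closed => // s /andP[s0 s1].
have [->|sn0] := eqVneq s 0; first by rewrite scale0r; exact: radial_origin.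
have sp : 0 < s by rewrite lt0r sn0.
have tst : t < t / s by rewrite ltr_pdivlMr// gtr_pMr.
have := above _ tst; rewrite dilateE ?divr_gt0// => Ktx.
by rewrite scalerA; congr (K (_ *: _)) : Ktx; rewrite invf_div.
Qed.

Lemma exp_gauge_gt0 x : 0 < exp_gauge x ->
  exists t, [/\ 0 <= t, exp_gauge x = expR (- t) & dilate K t x].
Proof.
move=> x0; exists (- ln (exp_gauge x)).
have t0 : 0 <= - ln (exp_gauge x).
  by rewrite oppr_ge0 -ln1 ler_ln ?posrE// exp_gauge_le1.
have e : exp_gauge x = expR (- - ln (exp_gauge x)) by rewrite opprK lnK.
by split => //; apply/exp_gaugeP => //; rewrite -e.
Qed.

(** Convexity of the gauge, in multiplicative form. *)
Lemma exp_gauge_prod_le m (p : 'I_m -> R) (x : 'I_m -> 'rV[R]_n) :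
  (forall j, 0 < p j) ->
  \prod_j exp_gauge (x j) `^ p j <= exp_gauge (\sum_j p j *: x j).
Proof.
move=> p0.
have [/existsP[j /eqP xj]|] := boolP [exists j, exp_gauge (x j) == 0].
  rewrite (bigD1 j)//= xj powR0 ?mul0r ?exp_gauge_ge0//.
  by rewrite gt_eqF.
rewrite negb_exists => /forallP xn0.
have /choice[t tP] j : exists t, [/\ 0 <= t, exp_gauge (x j) = expR (- t) & dilate K t (x j)].
  by apply: exp_gauge_gt0; rewrite lt0r xn0 exp_gauge_ge0.
have -> : \prod_j exp_gauge (x j) `^ p j = expR (- \sum_j p j * t j).
  rewrite -sumrN expR_sum; apply: eq_bigr => j _; have [_ -> _] := tP j.
  by rewrite -expRM mulrC mulrN.
have ge0 j : 0 <= p j * t j by rewrite mulr_ge0 ?(ltW (p0 j))//; have [] := tP j.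
apply/exp_gaugeP; first by apply: sumr_ge0 => j _.
suff [] : 0 <= \sum_j p j * t j /\ dilate K (\sum_j p j * t j) (\sum_j p j *: x j) by [].
elim/big_ind2 : _ => [|s y s' y' [s0 Ky] [s0' Ky']|j _].
- by split => //; exists 0; [exact: radial_origin|rewrite scaler0].
- by split; [exact: addr_ge0|exact: dilateD].
- by split => //; apply: dilateM; have [] := tP j.
Qed.

Lemma measurable_exp_gauge :
  measurable_fun setT (fun z : n.-tuple T => exp_gauge (row_of_tuple z) : T).
Proof.
apply: (measurability _ (RGenCInfty.measurableE R)) => //.
move=> _ [_ [a ->] <-]; rewrite setTI.
have [a0|a0] := leP a 0.
  rewrite (_ : _ @^-1` _ = setT)//; apply/seteqP; split => // z _ /=.
  by rewrite in_itv/= andbT (le_trans a0)// exp_gauge_ge0.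
have [a1|a1] := ltP 1 a.
  rewrite (_ : _ @^-1` _ = set0)//; apply/seteqP; split => // z /=.
  by rewrite in_itv/= andbT leNgt (le_lt_trans (exp_gauge_le1 _) a1).
have ae : expR (- - ln a) = a by rewrite opprK lnK.
have t0 : 0 <= - ln a by rewrite oppr_ge0 -ln1 ler_ln ?posrE.
rewrite (_ : _ @^-1` _ = @row_of_tuple R n @^-1` dilate K (- ln a)); last first.
  apply/seteqP; split => z /=; rewrite in_itv/= andbT.
    by move=> az; apply/exp_gaugeP => //; rewrite ae.
  by move=> /(exp_gaugeP _ t0); rewrite ae.
have := t0; rewrite le_eqVlt => /predU1P[<-|tp].
  have := @measurable_box n (fun=> [set 0]) (fun=> measurable_set1 _).
  congr measurable; apply/seteqP; split => z /=.
    move=> z0; exists 0; first exact: radial_origin.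
    by rewrite scaler0; apply/rowP => i; rewrite !mxE z0.
  by move=> [y _ /rowP zy] i; have := zy i; rewrite !mxE mul0r.
have := row_measurable_mul ((- ln a)^-1)%:M (radial_measurable bK).
congr measurable; apply/seteqP; split => z /=; rewrite mul_mx_scalar => h; exact/dilateE.
Qed.


Definition decay (c t : R) : R := expR (- (c * `|t|)).

Lemma continuous_decay c : continuous (decay c).
Proof.
move=> t; apply: continuous_comp; last exact: continuous_expR.
apply: continuousN; apply: continuousM; first exact: cst_continuous.
exact: norm_continuous.
Qed.

Lemma measurable_decay c : measurable_fun setT (decay c : T -> R).
Proof. exact: continuous_measurable_fun (@continuous_decay c). Qed.

Lemma decay_ge0 c t : 0 <= decay c t. Proof. exact: expR_ge0. Qed.

Lemma decay_le1 c t : 0 <= c -> decay c t <= 1.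
Proof. by move=> c0; rewrite -expR0 ler_expR oppr_le0 mulr_ge0. Qed.

Lemma integral_decay c : 0 < c -> (\int[leb]_t (decay c t)%:E = (2 / c)%:E)%E.
Proof.
move=> c0.
transitivity (\int[leb]_t ((decay 1 (c * t + 0)%R)%:E : \bar R))%E.
  apply: eq_integral => t _; rewrite /decay addr0 mul1r normrM gtr0_norm//.
rewrite (@ge0_integral_aff R c 0 (fun t => (decay 1 t)%:E)) ?gt_eqF//; last 2 first.
  by apply/measurable_EFinP; exact: measurable_decay.
  by move=> t; rewrite lee_fin decay_ge0.
rewrite gtr0_norm// EFinM muleC; congr (_ * _)%E.
rewrite ge0_symfun_integralT//; last 3 first.
- exact: decay_ge0.
- exact: continuous_decay.
- by move=> t; rewrite /decay /= normrN.
rewrite (_ : mkset _ = `[0, +oo[%classic); last first.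
  by apply/seteqP; split => t /=; rewrite in_itv/= andbT.
rewrite (_ : (\int[_]_(t in _) _)%E = 1%E) ?mule1//.
transitivity (\int[leb]_(t in `[0%R, +oo[) (t ^+ 0 * expR (- t))%:E)%E.
  apply: eq_integral => t; rewrite inE/= in_itv/= andbT => t0.
  by rewrite expr0 mul1r /decay mul1r ger0_norm.
by rewrite integral_exprn_expRN.
Qed.

(** If K lies in the cube of half-width r, a point x of t K satisfies
    |x_i| <= t r for all i, so that t is at least the average of the
    |x_i| / r. *)
Lemma exp_gauge_decay : exists2 c, 0 < c &
  forall x, exp_gauge x <= \prod_(i < n) decay c (x 0 i).
Proof.
have [r r0 Kr] := radial_bounded bK.
have n0 : 0 < n.+1%:R :> R by rewrite ltr0n.
(* dividing by n.+1 rather than by n covers the case n = 0 *)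
exists (n.+1%:R * r)^-1; first by rewrite invr_gt0 mulr_gt0.
move=> x; have := exp_gauge_ge0 x; rewrite le_eqVlt => /predU1P[<-|].
  by apply: prodr_ge0 => i _; exact: decay_ge0.
move=> /exp_gauge_gt0[t [t0 -> [y Ky <-]]].
rewrite -expR_sum ler_expR sumrN lerN2.
apply: (@le_trans _ _ (\sum_(i < n) (t / n.+1%:R))).
  apply: ler_sum => i _; rewrite mxE normrM (ger0_norm t0).
  have -> : (n.+1%:R * r)^-1 * (t * `|y 0 i|) = t / n.+1%:R * (`|y 0 i| / r).
    by field; rewrite !gt_eqF.
  by rewrite ler_piMr ?divr_ge0 ?ler_pdivrMr ?mul1r ?Kr.
rewrite sumr_const card_ord -[_ *+ n]mulr_natr -mulrA ler_piMr//.
by rewrite ler_pdivrMl// mulr1 ler_nat.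
Qed.

Lemma dominated_exp_gauge : exists2 c, 0 < c &
  dominated (decay c) (fun z : n.-tuple T => exp_gauge (row_of_tuple z)).
Proof.
have [c c0 Kc] := exp_gauge_decay; exists c => //; split.
- exact: measurable_exp_gauge.
- by move=> z; exact: exp_gauge_ge0.
- exists 1 => // z; rewrite mul1r; apply: le_trans (Kc _) _.
  by under eq_bigr do rewrite mxE.
Qed.

Lemma row_measure_dilate t : 0 < t ->
  (row_measure (dilate K t) = (t ^+ n)%:E * row_measure K)%E.
Proof.
move=> t0.
transitivity (row_measure [set x | K (x *m (t^-1)%:M)]).
  congr row_measure; apply/seteqP; split => x /=; rewrite mul_mx_scalar => h.
    exact/dilateE.
  exact/dilateE.
have ti : t^-1 != 0 by rewrite invr_eq0 gt_eqF.
rewrite (@scales_volume_unit R n) ?unitmxE ?det_scalar ?unitrX ?unitfE//.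
  by rewrite exprVn normfV invrK ger0_norm// exprn_ge0// ltW.
exact: radial_measurable.
Qed.

(** The superlevel set of exp_gauge at height exp (- t) is the dilate of K by t,
    whose measure grows as t ^ n; this turns the integral into a Gamma
    integral. *)
Lemma integral_exp_gauge :
  (\int[@lebesgue_tuple R n]_z (exp_gauge (row_of_tuple z))%:E =
   (n`!%:R)%:E * row_measure K)%E.
Proof.
pose w (s : R) := expR (- s).
have mw : measurable_fun setT (w : T -> R).
  exact: continuous_measurable_fun (@continuous_expRN R).
pose E : set (n.-tuple T * T) := [set u | 0 <= u.2] `&`
  [set u | w u.2 <= exp_gauge (row_of_tuple u.1)].
have mE : measurable E.
  apply: measurableI.
    by apply: (@measurable_ler_set R _ _ (cst 0) snd) => //; exact: measurable_snd.
  apply: (@measurable_ler_set R _ _ (w \o snd) ((exp_gauge \o @row_of_tuple R n) \o fst)).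
    by apply: (measurableT_comp mw); exact: measurable_snd.
  by apply: (measurableT_comp measurable_exp_gauge); exact: measurable_fst.
have w0 s : 0 <= w s by exact: expR_ge0.
transitivity (\int[@lebesgue_tuple R n]_z \int[leb]_s ((w s)%:E * (\1_E (z, s))%:E))%E.
  apply: eq_integral => z _; have := exp_gauge_ge0 (row_of_tuple z).
  rewrite le_eqVlt => /predU1P[z0|/exp_gauge_gt0[t [t0 zt Kt]]].
    rewrite -z0 integral0_eq// => s _; rewrite indicE memNset ?mule0// /E /= => -[_].
    by rewrite -z0 leNgt expR_gt0.
  rewrite zt -integral_expRN_tail integral_mkcond; apply: eq_integral => s _.
  rewrite patchE indicE.
  have -> : (s \in `[t, +oo[%classic) = ((z, s) \in E).
    apply/idP/idP; rewrite !inE/= in_itv/= andbT /E/=.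
      move=> ts; split; first exact: le_trans ts.
      by apply/exp_gaugeP; [exact: le_trans ts|exact: dilate_le ts Kt].
    by move=> [_]; rewrite zt ler_expR lerN2.
  by case: (_ \in E); rewrite ?mule1 ?mule0.
rewrite (@layer_cake_weight R _ _ (@lebesgue_tuple R n) w E w0 mw mE).
have mEs : measurable_fun setT (fun s : T => ((w s)%:E * @lebesgue_tuple R n [set x | E (x, s)])%E).
  apply: emeasurable_funM; first exact/measurable_EFinP.
  have := measurable_fun_ysection (@lebesgue_tuple R n) mE.
  congr measurable_fun; apply/funext => s /=; congr lebesgue_tuple.
  by apply/seteqP; split => x /=; rewrite /ysection/= inE.
transitivity (\int[leb]_(s in `[0%R, +oo[) ((w s)%:E * @lebesgue_tuple R n [set x | E (x, s)]))%E.
  rewrite [RHS]integral_mkcond; apply: eq_integral => s _; rewrite patchE.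
  case: ifPn => //; rewrite notin_setE/= in_itv/= andbT => /negP s0.
  rewrite (_ : mkset _ = set0) ?measure0 ?mule0//.
  by apply/seteqP; split => // x [/= s1 _]; rewrite s1 in s0.
rewrite -integral_itv_obnd_cbnd; last exact: measurable_funTS.
transitivity (\int[leb]_(s in `]0%R, +oo[) ((s ^+ n * expR (- s))%:E * row_measure K))%E.
  apply: eq_integral => s; rewrite inE/= in_itv/= andbT => s0.
  rewrite [s ^+ n * _]mulrC EFinM -muleA -row_measure_dilate//.
  congr (_ * lebesgue_tuple _)%E; apply/seteqP; split => z /=.
    by move=> [_ /(exp_gaugeP _ (ltW s0))].
  by move=> Kz; split => /=; [exact: ltW|apply/exp_gaugeP => //; exact: ltW].
have mse : measurable_fun setT (fun s : T => ((s ^+ n * expR (- s))%:E)).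
  by apply/measurable_EFinP; apply: measurable_funM; last exact: mw.
rewrite integral_itv_obnd_cbnd; last first.
  by apply: measurable_funTS; apply: emeasurable_funM => //; exact: measurable_cst.
rewrite ge0_integralZr//; first by rewrite integral_exprn_expRN.
- exact: measurable_funTS.
- move=> s /=; rewrite in_itv/= andbT => s0.
  by rewrite lee_fin mulr_ge0 ?expR_ge0// exprn_ge0.
Qed.

End exp_gauge.

(** * Selections of coordinates *)

Section selection.
Context {R : realType}.
Local Notation leb := (@lebesgue_measure R).
Local Notation T := (measurableTypeR R).

Definition coord_mx n (S : {set 'I_n}) : 'M[R]_(#|S|, n) :=
  \matrix_(k, i) (i == enum_val k)%:R.

Lemma coord_mx_mul n l (S : {set 'I_n}) (V : 'M[R]_(n, l)) k :
  row k (coord_mx S *m V) = row (enum_val k) V.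
Proof.
apply/rowP => j; rewrite !mxE (bigD1 (enum_val k))//= mxE eqxx mul1r.
by rewrite big1 ?addr0// => i /negbTE ik; rewrite mxE ik mul0r.
Qed.

Lemma coord_mxK n (S : {set 'I_n}) : coord_mx S *m (coord_mx S)^T = 1%:M.
Proof.
apply/row_matrixP => k; rewrite coord_mx_mul; apply/rowP => l.
by rewrite !mxE (inj_eq enum_val_inj).
Qed.

Lemma coord_mx_tr_mul n (S : {set 'I_n}) :
  (coord_mx S)^T *m coord_mx S = diag_mx (\row_i (i \in S)%:R).
Proof.
apply/matrixP => i j; rewrite !mxE.
have [iS|iS] := boolP (i \in S).
  rewrite (bigD1 (enum_rank_in iS i))//= !mxE enum_rankK_in// eqxx mul1r eq_sym.
  rewrite big1 ?addr0// => k kn; rewrite !mxE.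
  case: (i =P enum_val k) => [ik|_]; last by rewrite mul0r.
  by move: kn; rewrite -[k](enum_valK_in iS) -ik eqxx.
rewrite mul0rn big1// => k _; rewrite !mxE.
case: (i =P enum_val k) => [ik|_]; last by rewrite mul0r.
by rewrite ik enum_valP in iS.
Qed.

Lemma coord_mx_setC n (S : {set 'I_n}) : coord_mx S *m (coord_mx (~: S))^T = 0.
Proof.
apply/row_matrixP => k; rewrite coord_mx_mul; apply/rowP => l.
rewrite !mxE; case: eqP => // kl.
by have := enum_valP l; rewrite -kl inE enum_valP.
Qed.

(** The numbers of rows and columns are only propositionally equal: P will stack
    the selections of a set and of its complement. *)
Lemma orthogonal_rows_det d k (e : d = k) (P : 'M[R]_(d, k)) (A : 'M[R]_k) :
  P *m P^T = 1%:M -> \det (P *m A *m P^T) = \det A.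
Proof.
case: _ / e A P => A P PP; rewrite !det_mulmx mulrAC -det_mulmx PP det1 mul1r.
by [].
Qed.

(** The scaling formula survives the passage to real values, since both sides
    are 0 when the measure is infinite. *)
Lemma volume_mulmx n (A : 'M[R]_n) (E : set 'rV[R]_n) : A \in unitmx ->
  row_measurable E -> volume [set x | E (x *m A)] = `|\det A|^-1 * volume E.
Proof.
move=> uA mE; rewrite /volume -!/(row_measure _).
have /= -> := scales_volume_unit uA mE.
have : 0 < `|\det A|^-1.
  by rewrite invr_gt0 normr_gt0; move: uA; rewrite unitmxE unitfE.
have : (0 <= row_measure E)%E by exact: measure_ge0.
case: (row_measure E) => [r| |]//= _ a0; first by rewrite gt0_muley//= mulr0.
Qed.

(** Two selections of the same coordinates differ by an orthogonal matrix. *)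
Lemma volume_selection n d (S : {set 'I_n}) (G : 'M[R]_(d, n)) (K : set 'rV[R]_n) :
  G *m G^T = 1%:M -> G^T *m G = diag_mx (\row_i (i \in S)%:R) -> row_measurable K ->
  d = #|S| /\
  volume [set z | K (z *m G)] = volume [set z | K (z *m coord_mx S)].
Proof.
move=> GG GTG mK.
have dS : d = #|S|.
  have : (d%:R : R) = #|S|%:R.
    transitivity (\tr (1%:M : 'M[R]_d)); first by rewrite mxtrace1.
    by rewrite -GG mxtrace_mulC GTG -coord_mx_tr_mul mxtrace_mulC coord_mxK mxtrace1.
  by move/eqP; rewrite eqr_nat => /eqP.
split=> //; subst d.
pose C := G *m (coord_mx S)^T.
have CS : C *m coord_mx S = G by rewrite -mulmxA coord_mx_tr_mul -GTG mulmxA GG mul1mx.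
have CC : C *m C^T = 1%:M.
  by rewrite {2}/C trmx_mul trmxK mulmxA CS.
have uC : C \in unitmx by apply: (mulmx1_unit CC).1.
have dC : `|\det C| = 1.
  have : \det C ^+ 2 = 1 by rewrite expr2 -{2}det_tr -det_mulmx CC det1.
  by move=> /eqP; rewrite sqrf_eq1 => /orP[] /eqP ->; rewrite ?normrN normr1.
have := @volume_mulmx _ C [set z | K (z *m coord_mx S)] uC (row_measurable_mul _ mK).
rewrite dC invr1 mul1r => <-.
by congr volume; apply/seteqP; split => z /=; rewrite -mulmxA CS.
Qed.

Lemma tuple_of_row_mx n t (x : 'rV[R]_n) :
  tuple_of_row (row_mx t%:M x : 'rV[R]_(1 + n)) = [tuple of (t : T) :: tuple_of_row x].
Proof.
apply: (can_inj (@row_of_tupleK R _)); rewrite tuple_of_rowK.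
by have := row_of_cons t (tuple_of_row x); rewrite tuple_of_rowK => <-.
Qed.

(** Unfolding the recursion of coord_integral builds a selection G row by row.
    It is only characterised by its Gram matrices, which is all that
    volume_selection needs to replace it by coord_mx. *)
Lemma coord_integralE n c (b : 'I_n -> bool) : 0 < c ->
  exists d (G : 'M[R]_(d, n)), [/\ G *m G^T = 1%:M,
    G^T *m G = diag_mx (\row_i (b i)%:R) &
    forall f, dominated (decay c) f ->
      ((coord_integral b f)%:E = \int[@lebesgue_tuple R d]_z
        (f (tuple_of_row (row_of_tuple z *m G)))%:E)%E].
Proof.
move=> c0.
have mq := measurable_decay c.
have q0 := @decay_ge0 R c.
have q1 t : decay c t <= 1 by apply: decay_le1; exact: ltW.
have intq := integral_decay c0.
elim: n b => [|n IHn] b.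
  exists 0%N, 0; split; [by apply/matrixP => -[]|by apply/matrixP => -[]|].
  move=> f [mf _ _]; rewrite /= integral_dirac//.
    by rewrite diracE mem_set// mul1e [tuple_of_row _]tuple0.
  by apply/measurable_EFinP; rewrite (_ : (fun _ => _) = cst (f [tuple]))//; apply/funext => z; rewrite [tuple_of_row _]tuple0.
have [d [G [GG GTG IG]]] := IHn (fun i => b (lift ord0 i)).
have diagE : diag_mx (\row_i (b i)%:R) =
   block_mx ((b ord0)%:R)%:M 0 0 (diag_mx (\row_i (b (lift ord0 i))%:R)) :> 'M[R]_(1 + n).
  apply/matrixP => i j; rewrite mxE mxE [RHS]mxE.
  case: (splitP i) => i' ii; rewrite [RHS]mxE; case: (splitP j) => j' jj.
  - have -> : i = ord0 by apply/val_inj; rewrite /= ii ord1.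
    have -> : j = ord0 by apply/val_inj; rewrite /= jj ord1.
    by rewrite !mxE !ord1 !eqxx.
  - by rewrite mxE -val_eqE /= ii jj ord1 mulr0n.
  - by rewrite mxE -val_eqE /= ii jj ord1 mulr0n.
  have -> : i = lift ord0 i' by apply/val_inj; rewrite /= ii.
  have -> : j = lift ord0 j' by apply/val_inj; rewrite /= jj.
  by rewrite !mxE (inj_eq lift_inj).
case b0 : (b ord0) diagE => diagE.
  pose G' := block_mx 1%:M 0 0 G : 'M[R]_(1 + d, 1 + n).
  have G'G' : G' *m G'^T = 1%:M.
    rewrite tr_block_mx mulmx_block !trmx0 !mulmx0 !mul0mx trmx1 mulmx1 GG !addr0 add0r.
    by rewrite -scalar_mx_block.
  have G'TG' : G'^T *m G' = diag_mx (\row_i (b i)%:R).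
    rewrite diagE tr_block_mx mulmx_block !trmx0 !mulmx0 !mul0mx trmx1 mulmx1 GTG.
    by rewrite !addr0 add0r.
  exists d.+1, G'; split => //.
  move=> f df; have [mf f0 _] := df.
  rewrite integral_cons_tuple//; last first.
    apply: (measurableT_comp mf).
    have := measurable_affine_tuple G' 0.
    by congr measurable_fun; apply/funext => z; rewrite addr0.
  rewrite /= b0 IG; last exact: (dominated_marginal mq q0 q1 intq).
  apply: eq_integral => z _; rewrite -(marginalE mq q0 intq)//.
  apply: eq_integral => t _; congr (f _)%:E; rewrite -tuple_of_row_mx.
  have -> : row_mx t%:M (row_of_tuple z *m G) = row_mx t%:M (row_of_tuple z) *m G'.
    by rewrite /G' mul_row_block !mulmx0 mulmx1 addr0 add0r.
  by congr (tuple_of_row (_ *m _)); exact/esym/row_of_cons.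
pose G' := row_mx 0 G : 'M[R]_(d, 1 + n).
have G'G' : G' *m G'^T = 1%:M by rewrite tr_row_mx mul_row_col mul0mx add0r.
have G'TG' : G'^T *m G' = diag_mx (\row_i (b i)%:R).
  by rewrite diagE tr_row_mx mul_col_row trmx0 !mul0mx mulmx0 GTG raddf0.
exists d, G'; split => //.
move=> f df; rewrite /= b0 IG; last exact: (dominated_marginal mq q0 q1 intq).
apply: eq_integral => z _; congr (f _)%:E; rewrite -tuple_of_row_mx; congr tuple_of_row.
have := mul_mx_row (row_of_tuple z) (0 : 'M[R]_(d, 1)) G.
by rewrite mulmx0 raddf0 => ->.
Qed.

End selection.

(** * Sections by coordinate subspaces and Gram volumes *)

Section coordinate_sections.
Context {R : realType}.
Local Notation leb := (@lebesgue_measure R).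
Local Notation T := (measurableTypeR R).

Lemma exp_gauge_preimage k n (G : 'M[R]_(k, n)) (K : set 'rV[R]_n) z :
  row_free G -> K 0 -> exp_gauge K (z *m G) = exp_gauge [set z | K (z *m G)] z.
Proof.
move=> Gfree K0; congr (sup (_ @` _)); apply/seteqP; split => t /= [t0 Kt]; split => //.
  have := t0; rewrite le_eqVlt => /predU1P[te|tp].
    move: Kt; rewrite -te => -[y _ zG]; exists 0 => /=; first by rewrite mul0mx.
    rewrite scaler0; apply: (row_free_inj Gfree).
    by rewrite mul0mx -zG scale0r.
  by apply/dilateE => //=; rewrite -scalemxAl; apply/dilateE.
by case: Kt => y Ky <-; exists (y *m G) => //; rewrite scalemxAl.
Qed.

Lemma fine_mul_fact n (x : R) (mu : \bar R) : (x%:E = (n`!%:R)%:E * mu)%E ->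
  x = n`!%:R * fine mu.
Proof.
have n0 : (0 < (n`!%:R : R)%:E)%E by rewrite lte_fin ltr0n fact_gt0.
by case: mu => [r [->]||]//; rewrite ?gt0_muley// gt0_muleNy.
Qed.

Lemma coord_integral_exp_gauge n (S : {set 'I_n}) (K : set 'rV[R]_n) :
  radial_body K ->
  coord_integral (fun i => i \in S) (fun z : n.-tuple T => exp_gauge K (row_of_tuple z)) =
  (#|S|)`!%:R * volume [set z | K (z *m coord_mx S)].
Proof.
move=> bK; have [c c0 dK] := dominated_exp_gauge bK.
have [d [G [GG GTG IG]]] := coord_integralE (fun i => i \in S) c0.
have Gfree : row_free G by apply/row_freeP; exists G^T.
have [dS <-] := volume_selection GG GTG (radial_measurable bK); rewrite -dS.
apply: fine_mul_fact; rewrite IG//.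
rewrite -(integral_exp_gauge (radial_body_preimage Gfree bK)).
apply: eq_integral => z _; rewrite tuple_of_rowK exp_gauge_preimage//.
exact: radial_origin.
Qed.

(** By convexity of the gauge, exp (- gauge) can play the role of all the
    functions in the reverse Finner inequality; its integrals over the whole
    space and over each coordinate subspace are given by integral_exp_gauge. *)
Theorem coordinate_sections_volume n m (S : 'I_m -> {set 'I_n}) (p : 'I_m -> R)
    (K : set 'rV[R]_n) : uniform_cover S p -> radial_body K ->
  \prod_(j < m) ((#|S j|)`!%:R * volume [set z | K (z *m coord_mx (S j))]) `^ p j <=
  n`!%:R * volume K.
Proof.
move=> [p0 cov] bK; have [c c0 dK] := dominated_exp_gauge bK.
have -> : n`!%:R * volume K = coord_integral (fun=> true)
    (fun z : n.-tuple T => exp_gauge K (row_of_tuple z)).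
  apply/esym/fine_mul_fact; rewrite -integral_exp_gauge//.
  rewrite (@coord_integral_full _ (decay c) (2 / c))//.
  - exact: measurable_decay.
  - exact: decay_ge0.
  - by move=> t; apply: decay_le1; exact: ltW.
  - exact: integral_decay.
under eq_bigr do rewrite -coord_integral_exp_gauge//.
apply: (@reverse_finner R (decay c) (2 / c)) => //.
- exact: measurable_decay.
- exact: decay_ge0.
- by move=> t; apply: decay_le1; exact: ltW.
- exact: integral_decay.
move=> x _; rewrite (_ : row_of_tuple _ = \sum_j p j *: row_of_tuple (x j)).
  exact: exp_gauge_prod_le.
apply/rowP => i; rewrite mxE tnth_mktuple summxE.
by apply: eq_bigr => j _; rewrite !mxE.
Qed.

End coordinate_sections.

Section gram.
Context {R : realType}.
Local Notation T := (measurableTypeR R).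

Definition gram_volume d n (D : 'M[R]_(d, n)) : R := Num.sqrt (\det (D *m D^T)).

Lemma gram_volume_square n (D : 'M[R]_n) : gram_volume D = `|\det D|.
Proof. by rewrite /gram_volume det_mulmx det_tr -expr2 sqrtr_sqr. Qed.

(** Volumes in a subspace F measured in the coordinates of an arbitrary basis:
    the Jacobian of the passage to an orthonormal basis is the Gram volume. *)
Lemma subspace_volume_basis l d n (F : 'M[R]_(l, n)) (D : 'M[R]_(d, n))
    (A : set 'rV[R]_n) : row_free D -> (D == F)%MS ->
  row_measurable [set z | A (z *m D)] ->
  0 < gram_volume D /\
  subspace_volume F A = gram_volume D * volume [set z | A (z *m D)].
Proof.
move=> Dfree DF; rewrite /subspace_volume.
have [BB /eqmxP BF] := orthonormal_basisP F.
move: (orthonormal_basis F) BB BF => B BB BF.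
have rd : \rank F = d by rewrite -(eqmx_rank DF); apply/eqP.
have DB : (D <= B)%MS by rewrite BF (eqmxP DF).
move: (\rank F) B BB BF DB rd => r B BB BF DB rd; subst r.
move=> mA.
pose C := D *m B^T.
have CB : C *m B = D.
  by have /submxP[X DX] := DB; rewrite /C DX -(mulmxA X) BB mulmx1.
have CC : D *m D^T = C *m C^T by rewrite -{1 2}CB trmx_mul mulmxA -(mulmxA C) BB mulmx1.
have gC : gram_volume D = `|\det C| by rewrite -gram_volume_square /gram_volume CC.
have uC : C \in unitmx.
  rewrite -row_free_unit -row_leq_rank -{1}(eqP Dfree) -CB.
  exact: mxrankM_maxl.
rewrite gC normr_gt0; split; first by move: uC; rewrite unitmxE unitfE.
transitivity (volume [set y | [set z | A (z *m D)] (y *m invmx C)]).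
  congr volume; apply/seteqP; split => y /=;
  by rewrite -CB mulmxA mulmxKV.
by rewrite volume_mulmx ?unitmx_inv// det_inv normfV invrK.
Qed.

Lemma coord_mx_row_free n (S : {set 'I_n}) (V : 'M[R]_n) : V \in unitmx ->
  row_free (coord_mx S *m V).
Proof.
move=> uV; apply/row_freeP; exists (invmx V *m (coord_mx S)^T).
by rewrite mulmxA mulmxK// coord_mxK.
Qed.

Lemma coord_mx_span n (S : {set 'I_n}) (V : 'M[R]_n) :
  (coord_mx S *m V == spanmx (fun k => row k V) S)%MS.
Proof.
apply/andP; split.
  apply/row_subP => k; rewrite coord_mx_mul.
  apply: (sumsmx_sup (enum_val k)); first exact: enum_valP.
  by rewrite genmxE.
apply/sumsmx_subP => i iS; rewrite genmxE.
have := row_sub (enum_rank_in iS i) (coord_mx S *m V).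
by rewrite coord_mx_mul enum_rankK_in.
Qed.

Lemma volume_cube n : volume [set z : 'rV[R]_n | forall i, 0 <= z 0 i <= 1] = 1.
Proof.
rewrite /volume (_ : _ @^-1` _ =
    [set t : n.-tuple T | forall i, `[0, 1]%classic (tnth t i)]); last first.
  apply/seteqP; split => t /= ht i; have := ht i; rewrite in_itv/= mxE//.
rewrite (@lebesgue_tuple_box R n (fun=> `[0, 1]%classic))//.
by rewrite big1// => i _; rewrite lebesgue_measure_itv/= lte_fin ltr01 -EFinB subr0.
Qed.

Lemma wedge_norm_gram n (w : 'I_n -> 'rV[R]_n) (V : 'M[R]_n) (S : {set 'I_n}) :
  V \in unitmx -> (forall k, w k = row k V) ->
  wedge_norm w S = gram_volume (coord_mx S *m V).
Proof.
move=> uV /funext ->; set D := coord_mx S *m V.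
have Dfree : row_free D by exact: coord_mx_row_free.
have DF : (D == spanmx (fun k => row k V) S)%MS by exact: coord_mx_span.
rewrite /wedge_norm -(eqmx_rank DF) (eqP Dfree) eqxx.
have cubeE : [set z | parallelepiped (fun k => row k V) S (z *m D)] =
    [set z : 'rV[R]_#|S| | forall i, 0 <= z 0 i <= 1].
  have sumE (t : 'I_n -> R) : \sum_(k in S) t k *: row k V =
      (\row_k t (enum_val k)) *m D.
    rewrite mulmx_sum_row big_enum_val/=; apply: eq_bigr => k _.
    by rewrite mxE coord_mx_mul.
  apply/seteqP; split => z /=.
    move=> [t t01]; rewrite sumE => /(row_free_inj Dfree) -> i.
    by rewrite mxE.
  move=> z01; pose t := z *m coord_mx S.
  have tz k : t 0 (enum_val k) = z 0 k.
    rewrite -[z in RHS]mulmx1 -(coord_mxK S) mulmxA -/t [RHS]mxE.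
    rewrite (bigD1 (enum_val k))//= [_^T _ _]mxE [coord_mx _ _ _]mxE eqxx mulr1.
    rewrite big1 ?addr0// => i /negbTE ik.
    by rewrite [_^T _ _]mxE [coord_mx _ _ _]mxE ik mulr0.
  exists (t 0); last first.
    by rewrite sumE; congr (_ *m D); apply/rowP => k; rewrite mxE tz.
  move=> i; have [iS|iS] := boolP (i \in S).
    by rewrite -(enum_rankK_in iS iS) tz.
  rewrite mxE big1 ?lexx ?ler01// => k _; rewrite !mxE.
  by case: eqP => [ik|_]; rewrite ?mulr0//; rewrite ik enum_valP in iS.
have mcube : row_measurable [set z : 'rV[R]_#|S| | forall i, 0 <= z 0 i <= 1].
  have := @measurable_box R #|S| (fun=> `[0, 1]%classic) (fun=> measurable_itv _).
  congr measurable; apply/seteqP; split => t /= ht i; have := ht i; rewrite in_itv/= mxE//.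
have [|_ ->] := @subspace_volume_basis _ _ _ _ D (parallelepiped (fun k => row k V) S) Dfree DF.
  by rewrite cubeE.
by rewrite cubeE volume_cube mulr1.
Qed.

End gram.

(** * Convex bodies and dual bases *)

Section compact_convex.
Context {R : realType}.
Local Notation T := (measurableTypeR R).

(** An open set is the countable union of the boxes with rational corners that
    it contains. *)
Lemma row_measurable_open n (U : set 'rV[R]_n) : open U -> row_measurable U.
Proof.
move=> oU.
pose box (ab : n.-tuple (rat * rat)) : set (n.-tuple T) :=
  [set t | forall i, `]ratr (tnth ab i).1, ratr (tnth ab i).2[%classic (tnth t i)].
pose F ab := if `[< box ab `<=` @row_of_tuple R n @^-1` U >] then box ab else set0.
rewrite /row_measurable (_ : _ @^-1` _ = \bigcup_ab F ab).
  apply: countable_bigcupT_measurable => [|ab]; first exact: countableP.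
  rewrite /F; case: ifP => _ //.
  exact: (@measurable_box R n (fun i => `]ratr (tnth ab i).1, ratr (tnth ab i).2[%classic)).
apply/seteqP; split => [t Ut|t [ab _]]; last first.
  by rewrite /F; case: asboolP => // sub /sub.
have /nbhs_ballP[e /= e0 eU] : nbhs (row_of_tuple t) U by apply: open_nbhs_nbhs.
have /choice[ab abP] i : exists ab : rat * rat,
    tnth t i - e < ratr ab.1 < tnth t i /\ tnth t i < ratr ab.2 < tnth t i + e.
  have [a] := @rat_in_itvoo R (tnth t i - e) (tnth t i) ltac:(by rewrite ltrBlDr ltrDl).
  have [b] := @rat_in_itvoo R (tnth t i) (tnth t i + e) ltac:(by rewrite ltrDl).
  by rewrite !in_itv/= => bt a_t; exists (a, b).
exists [tuple ab i | i < n] => //.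
rewrite /F; case: asboolP => [_|[]].
  move=> i /=; rewrite tnth_mktuple in_itv/=.
  by have [/andP[_ ->] /andP[-> _]] := abP i.
move=> u bu; apply: (eU (row_of_tuple u)); split => // k i; rewrite ord1 !mxE.
have := bu i; rewrite /= tnth_mktuple in_itv/= => /andP[au ub].
have [/andP[ta _] /andP[_ bt]] := abP i.
by rewrite /ball/= ltr_norml; apply/andP; split; lra.
Qed.

Lemma row_measurable_closed n (K : set 'rV[R]_n) : closed K -> row_measurable K.
Proof.
move=> cK; rewrite /row_measurable -[K]setCK preimage_setC.
by apply: measurableC; exact: (row_measurable_open (closed_openC cK)).
Qed.

Lemma convex_body_radial n (K : set 'rV[R]_n) : convex_body K -> K 0 -> radial_body K.
Proof.
move=> [cK vK _] K0; have clK : closed K by apply: compact_closed => //; exact: norm_hausdorff.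
split => //.
- exact: row_measurable_closed.
- have [M [_ KM]] := compact_bounded cK.
  have M1 : M < `|M| + 1 by rewrite (le_lt_trans (ler_norm M))// ltrDl.
  exists (`|M| + 1); first by rewrite ltr_wpDl.
  move=> x Kx i; apply: le_trans (KM _ M1 _ Kx).
  have := mx_normrE x => xE; rewrite [leRHS]xE.
  by apply: (le_bigmax _ (fun ij : 'I_1 * 'I_n => `|x ij.1 ij.2|) (0, i)).
- move=> x y t Kx Ky /andP[t0 t1].
  have := vK x y (Itv01 t0 t1); rewrite !inE; exact.
move=> x Kx; rewrite -[x]scale1r.
apply: (@closed_cvg _ _ (1^'-) _ (fun s : R => s *: x) K clK) => //.
  near=> s; apply: Kx; apply/andP; split.
    by near: s; apply: nbhs_left_ge; exact: ltr01.
  by near: s; exact: nbhs_left_lt.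
by apply: cvg_at_left_filter; exact: scalel_continuous.
Unshelve. all: by end_near. Qed.

End compact_convex.

Section duality.
Context {R : realType}.

(** Replacing the first block column of N by that of the identity matrix turns
    the product M N = 1 into a block triangular one. *)
Lemma det_complementary_minor d e (M N : 'M[R]_(d + e)) : M *m N = 1%:M ->
  \det (ulsubmx M) = \det M * \det (drsubmx N).
Proof.
move=> MN.
have : M *m block_mx 1%:M (ursubmx N) 0 (drsubmx N) =
    block_mx (ulsubmx M) 0 (dlsubmx M) 1%:M.
  rewrite -{1}[M]submxK mulmx_block !mulmx0 !mulmx1 !addr0.
  have := MN; rewrite -{1}[M]submxK -{1}[N]submxK mulmx_block scalar_mx_block.
  by move=> /eq_block_mx[_ -> _ ->].
move=> /(congr1 determinant).
by rewrite det_mulmx det_ublock det_lblock !det1 mul1r mulr1 => ->.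
Qed.

(** The Gram matrices W W^T and V V^T of a basis and of its dual basis are inverse
    to each other, and conjugation by the orthogonal matrix P that stacks the
    two selections exhibits the two sides as complementary minors. *)
Lemma gram_volume_dual n (S : {set 'I_n}) (W : 'M[R]_n) : W \in unitmx ->
  gram_volume (coord_mx S *m (invmx W)^T) =
  gram_volume (coord_mx (~: S) *m W) / `|\det W|.
Proof.
move=> uW; set V := (invmx W)^T.
pose P := col_mx (coord_mx S) (coord_mx (~: S)) : 'M[R]_(_, n).
have PP : P *m P^T = 1%:M.
  rewrite tr_col_mx mul_col_row !coord_mxK coord_mx_setC.
  have := coord_mx_setC (R := R) (~: S); rewrite finset.setCK => ->.
  by rewrite -scalar_mx_block.
have e : (#|S| + #|~: S| = n)%N by rewrite cardsC card_ord.
have PP' : P^T *m P = 1%:M.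
  rewrite tr_col_mx mul_row_col !coord_mx_tr_mul -raddfD/=.
  rewrite -(@diag_const_mx _ n 1); congr diag_mx; apply/rowP => i; rewrite !mxE inE.
  by case: (i \in S); rewrite ?addr0 ?add0r.
pose A := W *m W^T; pose B := V *m V^T.
have BA : B *m A = 1%:M.
  rewrite /A /B /V trmxK trmx_inv -mulmxA (mulmxA (invmx W)) mulVmx// mul1mx.
  by rewrite mulVmx// unitmx_tr.
have conj1 (X Y : 'M[R]_n) : X *m Y = 1%:M -> P *m X *m P^T *m (P *m Y *m P^T) = 1%:M.
  by move=> XY; rewrite !mulmxA -(mulmxA _ P^T) PP' mulmx1 -(mulmxA P X) XY mulmx1 PP.
have := det_complementary_minor (conj1 _ _ BA).
rewrite orthogonal_rows_det// /P.
rewrite tr_col_mx mul_col_mx mul_col_row block_mxKul mul_col_mx mul_col_row block_mxKdr.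
rewrite {1}/B {1}/A => dE.
rewrite /gram_volume !trmx_mul !mulmxA.
rewrite !mulmxA in dE; rewrite dE.
have -> : \det B = (\det W)^-1 ^+ 2 by rewrite /B /V det_mulmx !det_tr det_inv expr2.
rewrite sqrtrM ?sqr_ge0//.
by rewrite sqrtr_sqr mulrC normfV.
Qed.

Lemma spanmx_dual n (S : {set 'I_n}) (W : 'M[R]_n) : W \in unitmx ->
  (coord_mx S *m (invmx W)^T == orthmx (spanmx (fun k => row k W) (~: S)))%MS.
Proof.
move=> uW; set D := coord_mx S *m _; set F := spanmx _ _.
have /eqmxP FE := coord_mx_span (~: S) W; rewrite -/F in FE.
have DF : (D <= orthmx F)%MS.
  apply/sub_kermxP.
  have /submxP[X ->] : (F <= coord_mx (~: S) *m W)%MS by rewrite FE.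
  rewrite /D !trmx_mul mulmxA mulmxA -(mulmxA _ (invmx W)^T) -trmx_mul mulmxV// trmx1 mulmx1.
  by rewrite coord_mx_setC mul0mx.
rewrite -(mxrank_leqif_eq DF).2 /orthmx mxrank_ker mxrank_tr.
have /eqP rD : row_free D by apply: coord_mx_row_free; rewrite unitmx_tr unitmx_inv.
have /eqP rF : row_free (coord_mx (~: S) *m W) by exact: coord_mx_row_free.
rewrite rD -FE rF; apply/eqP.
by have := cardsC S; rewrite card_ord => cS; rewrite -[X in (X - _)%N]cS addnK.
Qed.

End duality.

(** * Sections spanned by rows of a matrix *)

Section bounds.
Context {R : realType}.

(** Raising the hypothesis to the power s turns the weights p j / s into p j. *)
Lemma weighted_bound_pow m (p f g sv : 'I_m -> R) (s D N v : R) :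
  0 < s -> 0 < D -> 0 < N -> 0 <= v -> (forall j, 0 <= f j) ->
  (forall j, 0 < g j) -> (forall j, 0 <= sv j) ->
  D * \prod_(j < m) (f j * (sv j / g j)) `^ (p j / s) <= N * v ->
  ((\prod_(j < m) g j `^ p j) / D `^ s)^-1 * ((\prod_(j < m) f j `^ p j) / N `^ s) *
    \prod_(j < m) sv j `^ p j <= v `^ s.
Proof.
move=> s0 D0 N0 v0 f0 g0 sv0 le.
have sn0 := lt0r_neq0 s0.
have h0 j : 0 <= f j * (sv j / g j) by rewrite mulr_ge0// divr_ge0// ltW.
have P0 : 0 <= \prod_(j < m) (f j * (sv j / g j)) `^ (p j / s).
  by apply: prodr_ge0 => j _; exact: powR_ge0.
have := ge0_ler_powR (ltW s0) _ _ le.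
rewrite !nnegrE => /(_ (mulr_ge0 (ltW D0) P0) (mulr_ge0 (ltW N0) v0)).
rewrite (powRM _ (ltW D0) P0) (powRM _ (ltW N0) v0).
rewrite powR_prod; last by move=> j; exact: powR_ge0.
under eq_bigr => j _ do rewrite -powRrM divfK// !powRM ?divr_ge0 ?invr_ge0 ?(ltW (g0 j))// powRV ?(ltW (g0 j))//.
rewrite !big_split/= prodfV => le'.
have N1 : 0 < N `^ s by exact: powR_gt0.
rewrite invf_div.
rewrite -(ler_pM2l N1); apply: le_trans le'.
rewrite le_eqVlt; apply/orP; left; apply/eqP.
have : \prod_(j < m) g j `^ p j != 0 by rewrite gt_eqF// prodr_gt0// => j _; exact: powR_gt0.
move: (\prod_(j < m) g j `^ p j) => G G0.
by field; rewrite G0 gt_eqF.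
Qed.

Lemma section_volume n (V : 'M[R]_n) (S : {set 'I_n}) (F : 'M[R]_n)
    (K : set 'rV[R]_n) :
  V \in unitmx -> (coord_mx S *m V == F)%MS -> radial_body K ->
  0 < gram_volume (coord_mx S *m V) /\
  subspace_volume F (K `&` subspace_set F) =
    gram_volume (coord_mx S *m V) * volume [set z | K (z *m (coord_mx S *m V))].
Proof.
move=> uV VF bK; set D := coord_mx S *m V in VF *.
have sE : [set z | (K `&` subspace_set F) (z *m D)] = [set z | K (z *m D)].
  apply/seteqP; split => z /=; first by case.
  by move=> Kz; split => //=; rewrite /subspace_set/= -(eqmxP VF) submxMl.
have := @subspace_volume_basis R _ _ _ F D (K `&` subspace_set F).
rewrite sE; apply => //; first exact: coord_mx_row_free.
exact: row_measurable_mul (radial_measurable bK).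
Qed.

(** The linear map taking the standard basis to the rows of V turns the
    inequality for coordinate subspaces into one for the spans of rows of V. *)
Theorem row_sections_volume n m (V : 'M[R]_n) (S : 'I_m -> {set 'I_n})
    (F : 'I_m -> 'M[R]_n) (p : 'I_m -> R) (s : R) (K : set 'rV[R]_n) :
  V \in unitmx -> (forall j, (coord_mx (S j) *m V == F j)%MS) ->
  0 < s -> uniform_cover S (fun j => p j / s) -> radial_body K ->
  ((\prod_(j < m) gram_volume (coord_mx (S j) *m V) `^ p j) / `|\det V| `^ s)^-1 *
  ((\prod_(j < m) (#|S j|)`!%:R `^ p j) / n`!%:R `^ s) *
  \prod_(j < m) subspace_volume (F j) (K `&` subspace_set (F j)) `^ p j
  <= volume K `^ s.
Proof.
move=> uV VF s0 cov bK.
have D0 : 0 < `|\det V| by rewrite normr_gt0; move: uV; rewrite unitmxE unitfE.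
have Vfree : row_free V by rewrite row_free_unit.
have volume_ge0 k (A : set 'rV[R]_k) : 0 <= volume A.
  by apply: fine_ge0; exact: measure_ge0.
have DF j := section_volume uV (VF j) bK.
apply: weighted_bound_pow => //.
- by move=> j; have [] := DF j.
- by move=> j; exact: volume_ge0.
have := coordinate_sections_volume cov (radial_body_preimage Vfree bK).
rewrite volume_mulmx//; last exact: radial_measurable.
rewrite mulrCA -ler_pdivrMl ?invr_gt0// invrK; apply: le_trans.
rewrite le_eqVlt; apply/orP; left; apply/eqP; congr (_ * _); apply: eq_bigr => j _.
have [g0 ->] := DF j; congr ((_ * _) `^ _).
rewrite mulrAC divff ?mul1r ?gt_eqF//.
by congr volume; apply/seteqP; split => z /=; rewrite mulmxA.
Qed.

Lemma uniform_cover_setC n m (S : 'I_m -> {set 'I_n}) (p : 'I_m -> R) :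
  uniform_cover S p ->
  forall i, \sum_(j < m) p j * (i \in ~: S j)%:R = \sum_(j < m) p j - 1.
Proof.
move=> [_ cov] i; rewrite -[X in _ - X](cov i) -sumrB; apply: eq_bigr => j _.
by rewrite inE; case: (i \in S j); rewrite /= !(mulr1, mulr0, subrr, subr0).
Qed.

Lemma dim0_gram_volume d n (D : 'M[R]_(d, n)) : d = 0%N -> gram_volume D = 1.
Proof. by move=> d0; subst d; rewrite /gram_volume det_mx00 sqrtr1. Qed.

Lemma dim0_volume d (A : set 'rV[R]_d) : d = 0%N -> A 0 -> volume A = 1.
Proof.
move=> d0; subst d => A0; rewrite -(volume_cube (R := R) 0).
congr volume; apply/seteqP; split => z /= _; first by case.
by rewrite (thinmx0 z).
Qed.

(** The complements of a uniform cover with weights p j form a uniform cover with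
    weights p j / s if s > 0, and are all empty otherwise. *)
Theorem row_cosections_volume n m (V : 'M[R]_n) (S : 'I_m -> {set 'I_n})
    (F : 'I_m -> 'M[R]_n) (p : 'I_m -> R) (K : set 'rV[R]_n) :
  let s := \sum_(j < m) p j - 1 in
  V \in unitmx -> (forall j, (coord_mx (~: S j) *m V == F j)%MS) ->
  uniform_cover S p -> radial_body K ->
  ((\prod_(j < m) gram_volume (coord_mx (~: S j) *m V) `^ p j) / `|\det V| `^ s)^-1 *
  ((\prod_(j < m) (#|~: S j|)`!%:R `^ p j) / n`!%:R `^ s) *
  \prod_(j < m) subspace_volume (F j) (K `&` subspace_set (F j)) `^ p j
  <= volume K `^ s.
Proof.
move=> s uV VF cov bK; have [p0 _] := cov.
have covC := uniform_cover_setC cov.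
have [s0|s0] := ltP 0 s.
  apply: row_sections_volume => //; split => [j|i]; first by rewrite divr_gt0.
  under eq_bigr do rewrite mulrAC.
  by rewrite -mulr_suml covC divff// gt_eqF.
(* no weight is left for the complements, so that they are all empty *)
have C0 j : #|~: S j| = 0%N.
  apply/eqP; rewrite cards_eq0; apply/eqP/setP => i; rewrite [RHS]inE.
  apply/negbTE/negP => iS; have : p j <= s.
    rewrite /s -(covC i) (bigD1 j)//= iS mulr1 lerDl sumr_ge0// => k _.
    by rewrite mulr_ge0// ltW.
  by rewrite leNgt (le_lt_trans s0 (p0 j)).
have one (x : 'I_m -> R) : (forall j, x j = 1) -> \prod_(j < m) x j `^ p j = 1.
  by move=> x1; rewrite big1// => j _; rewrite x1 powR1.
have pow1 (x : R) : (n = 0%N -> x = 1) -> x `^ s = 1.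
  move=> x1; case: (posnP n) => [/x1->|n0]; first by rewrite powR1.
  have -> : s = 0; last by rewrite powRr0.
  by rewrite /s -(covC (Ordinal n0)) big1// => j _; rewrite (cards0_eq (C0 j)) inE mulr0.
rewrite !one; first last.
- by move=> j; exact: dim0_gram_volume.
- by move=> j; rewrite C0.
- move=> j; have [_ ->] := section_volume uV (VF j) bK.
  by rewrite dim0_gram_volume// mul1r dim0_volume//= mul0mx; exact: radial_origin.
rewrite !pow1 ?divr1 ?invr1 ?mul1r//.
- by move=> n0; apply: dim0_volume => //; exact: radial_origin.
- by move=> ->.
- by move=> n0; subst n; rewrite det_mx00 normr1.
Qed.

End bounds.

(** * Sections spanned by a basis and by its complements *)

Lemma wedge_norm_full (R : realType) n (w : 'I_n -> 'rV[R]_n) (W : 'M[R]_n) :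
  W \in unitmx -> (forall k, w k = row k W) ->
  wedge_norm w [set: 'I_n]%SET = `|\det W|.
Proof.
move=> uW wW; rewrite (wedge_norm_gram _ uW wW) -gram_volume_square /gram_volume.
rewrite trmx_mul !mulmxA -(mulmxA _ W) orthogonal_rows_det ?coord_mxK//.
by rewrite cardsT card_ord.
Qed.

Lemma spanning_unitmx (R : realType) n (W : 'M[R]_n) :
  (spanmx (fun k => row k W) [set: 'I_n]%SET == 1%:M)%MS -> W \in unitmx.
Proof.
move=> /andP[_ le1]; rewrite -row_full_unit -sub1mx; apply: submx_trans le1 _.
by apply/sumsmx_subP => k _; rewrite genmxE row_sub.
Qed.

Theorem theorem1p6 (R : realType) (n m : nat) (w : 'I_n -> 'rV[R]_n)
    (S : 'I_m -> {set 'I_n}) (p : 'I_m -> R) (K : set 'rV[R]_n) :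
  (spanmx w [set: 'I_n]%SET == 1%:M)%MS ->
  (1 <= m)%N ->
  uniform_cover S p ->
  convex_body K ->
  K 0 ->
  let H j := spanmx w (S j) in
  let Ht j := spanmx w (~: S j) in
  let d j := \rank (H j) in
  let dt j := \rank (Ht j) in
  let psum := \sum_(j < m) p j in
  [/\ volume K >=
        (BL1 w S p)^-1 * ((\prod_(j < m) ((d j)`!)%:R `^ p j) / (n`!)%:R) *
        \prod_(j < m)
          subspace_volume (orthmx (Ht j))
            (K `&` subspace_set (orthmx (Ht j))) `^ p j,
      volume K `^ (psum - 1) >=
        (BL2 w S p)^-1 *
        ((\prod_(j < m) ((dt j)`!)%:R `^ p j) / (n`!)%:R `^ (psum - 1)) *
        \prod_(j < m)
          subspace_volume (orthmx (H j))
            (K `&` subspace_set (orthmx (H j))) `^ p j,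
      volume K >=
        (BL2 w S p)^-1 * ((\prod_(j < m) ((d j)`!)%:R `^ p j) / (n`!)%:R) *
        \prod_(j < m)
          subspace_volume (H j) (K `&` subspace_set (H j)) `^ p j
    & volume K `^ (psum - 1) >=
        (BL1 w S p)^-1 *
        ((\prod_(j < m) ((dt j)`!)%:R `^ p j) / (n`!)%:R `^ (psum - 1)) *
        \prod_(j < m)
          subspace_volume (Ht j) (K `&` subspace_set (Ht j)) `^ p j].
Proof.
move=> w1 _ cov cK K0 H Ht d dt psum.
have bK := convex_body_radial cK K0.
pose W : 'M[R]_n := \matrix_k w k.
have wW k : w k = row k W by rewrite rowK.
have wE : w = fun k => row k W by apply/funext.
have uW : W \in unitmx by apply: spanning_unitmx; rewrite -wE.
pose V := (invmx W)^T.
have uV : V \in unitmx by rewrite unitmx_tr unitmx_inv.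
have detV : `|\det V| = `|\det W|^-1 by rewrite det_tr det_inv normfV.
have W0 : 0 < `|\det W| by rewrite normr_gt0; move: uW; rewrite unitmxE unitfE.
have volume_ge0 : 0 <= volume K by apply: fine_ge0; exact: measure_ge0.
have fact_ge0 : 0 <= n`!%:R :> R by [].
have cov1 : uniform_cover S (fun j => p j / 1).
  by rewrite (_ : (fun _ => _) = p)//; apply/funext => j; rewrite divr1.
have VH (T : {set 'I_n}) : (coord_mx T *m V == orthmx (spanmx w (~: T)))%MS.
  by rewrite wE; exact: spanmx_dual.
have VHC (T : {set 'I_n}) : (coord_mx (~: T) *m V == orthmx (spanmx w T))%MS.
  by have := VH (~: T); rewrite finset.setCK.
have WH (T : {set 'I_n}) : (coord_mx T *m W == spanmx w T)%MS.
  by rewrite wE; exact: coord_mx_span.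
have gW (T : {set 'I_n}) : gram_volume (coord_mx T *m W) = wedge_norm w T.
  by rewrite (wedge_norm_gram _ uW wW).
have gV (T : {set 'I_n}) : gram_volume (coord_mx T *m V) = wedge_norm w (~: T) / `|\det W|.
  by rewrite gram_volume_dual// gW.
have wedge_ge0 (T : {set 'I_n}) : 0 <= wedge_norm w T by rewrite -gW sqrtr_ge0.
have dS j : d j = #|S j| by exact: rank_spanmx.
have dtS j : dt j = #|~: S j| by exact: rank_spanmx.
have wT := wedge_norm_full uW wW.
(* passing to the dual basis divides every Gram volume by the determinant *)
have dual_prod (Q : 'I_m -> {set 'I_n}) :
    \prod_(j < m) (wedge_norm w (Q j) / `|\det W|) `^ p j =
    (\prod_(j < m) wedge_norm w (Q j) `^ p j) / `|\det W| `^ psum.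
  rewrite powR_sum// -prodf_div; apply: eq_bigr => j _.
  by rewrite powRM ?invr_ge0 ?(ltW W0)// powRV// ltW.
have powRW x y : `|\det W| `^ (x - y) = `|\det W| `^ x / `|\det W| `^ y.
  by rewrite powRB//; apply/implyP => _; rewrite gt_eqF.
have powWn0 x : `|\det W| `^ x != 0 by rewrite gt_eqF// powR_gt0.
have powV x : `|\det V| `^ x = (`|\det W| `^ x)^-1.
  by rewrite detV powRV// ltW.
split.
- have := row_sections_volume uV (fun j => VH (S j)) ltr01 cov1 bK.
  rewrite !powRr1//.
  under eq_bigr do rewrite gV.
  rewrite dual_prod detV.
  under [X in _ * (X / _) * _]eq_bigr do rewrite -dS.
  apply: le_trans; rewrite le_eqVlt; apply/orP; left; apply/eqP.
  congr (_^-1 * _ * _); rewrite /BL1 wT powRW powRr1 ?(ltW W0)//.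
  by rewrite invrK invf_div mulrA mulrAC.
- have := row_cosections_volume uV (fun j => VHC (S j)) cov bK.
  under eq_bigr do rewrite gV finset.setCK.
  rewrite dual_prod powV.
  under [X in _ * (X / _) * _]eq_bigr do rewrite -dtS.
  apply: le_trans; rewrite le_eqVlt; apply/orP; left; apply/eqP.
  congr (_^-1 * _ * _); rewrite /BL2 wT powRW powRr1 ?(ltW W0)//.
  by rewrite invrK mulrA divfK.
- have := row_sections_volume uW (fun j => WH (S j)) ltr01 cov1 bK.
  rewrite !powRr1//.
  under eq_bigr do rewrite gW.
  under [X in _ * (X / _) * _]eq_bigr do rewrite -dS.
  by rewrite /BL2 wT.
have := row_cosections_volume uW (fun j => WH (~: S j)) cov bK.
under eq_bigr do rewrite gW.
under [X in _ * (X / _) * _]eq_bigr do rewrite -dtS.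
by rewrite /BL1 wT.
Qed.
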